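(* Suppose $g(x,y)$ is a semi-algebraic function of $(x,y)$, and suppose $g(x,y)$ is Morse in $y$ for almost every $x\in\mathcal{X}$. Then the upper Minkowski dimension $d$ of the bifurcation point set $\widetilde{\mathcal{X}}=\{x\in\mathcal{X}:g(x,\cdot)\text{ is not a Morse function}\}$ satisfies $d\le n-1$.
   Context: $\mathcal{X}\subset\mathbb{R}^n$ is convex and compact, and $g$ is a real-valued twice continuously differentiable function of $(x,y)$ with $x\in\mathcal{X}$, $y\in\mathbb{R}^m$. For fixed $x$, $g(x,\cdot)$ is Morse if $\nabla_yg(x,y)=0$ implies $\det(\nabla^2_{yy}g(x,y))\ne0$. A semi-algebraic function is one whose graph is a semi-algebraic set. For a bounded set $S\subset\mathbb{R}^n$, let $N(S,r)$ be the (minimal) number of balls of radius $r$ required to cover $S$; the upper Minkowski dimension is $\overline{\dim}_{\mathrm{box}}(S):=\limsup_{r\to0}\frac{\log N(S,r)}{-\log r}$. *)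

(* Defs.v *)
From HB Require Import structures.
From mathcomp Require Import all_boot all_order all_algebra.
From mathcomp Require Import all_classical all_reals all_analysis.
(* Its notations clash with those of MathComp-Analysis. *)
From mathcomp Require Import -(notations) mpoly.

Set Implicit Arguments.
Unset Strict Implicit.
Unset Printing Implicit Defensive.

Import Order.TTheory GRing.Theory Num.Theory.
Import numFieldNormedType.Exports.

Local Open Scope classical_set_scope.
Local Open Scope ring_scope.

(* [R^k] is ['rV[R]_k] and [(x, y)] in [R^n x R^m] is [row_mx x y]. *)

Definition partial (R : realType) (k : nat) (f : 'rV[R]_k -> R) (i : 'I_k) :
  'rV[R]_k -> R := 'D_(delta_mx 0 i) f.

Definition gradient (R : realType) (k : nat) (f : 'rV[R]_k -> R)
  (y : 'rV[R]_k) : 'rV[R]_k := \row_i partial f i y.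

Definition hessian (R : realType) (k : nat) (f : 'rV[R]_k -> R)
  (y : 'rV[R]_k) : 'M[R]_k := \matrix_(i, j) partial (partial f j) i y.

Definition C1_on (R : realType) (k : nat) (U : set 'rV[R]_k)
    (f : 'rV[R]_k -> R) :=
  forall (i : 'I_k) (p : 'rV[R]_k), U p ->
    derivable f p (delta_mx 0 i) /\ {for p, continuous (partial f i)}.

Definition C2_on (R : realType) (k : nat) (U : set 'rV[R]_k)
    (f : 'rV[R]_k -> R) :=
  C1_on U f /\ forall i : 'I_k, C1_on U (partial f i).

(* Twice continuously differentiable on a set [D] that need not be open, in
   the usual sense: [C^2] on some open neighbourhood of [D]. *)
Definition twice_continuously_differentiable (R : realType) (k : nat)
    (D : set 'rV[R]_k) (f : 'rV[R]_k -> R) :=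
  exists U : set 'rV[R]_k, [/\ open U, D `<=` U & C2_on U f].

Definition morse (R : realType) (m : nat) (f : 'rV[R]_m -> R) :=
  forall y : 'rV[R]_m, gradient f y = 0 -> \det (hessian f y) != 0.

Definition bifurcation_set (R : realType) (n m : nat) (X : set 'rV[R]_n)
    (g : 'rV[R]_(n + m) -> R) : set 'rV[R]_n :=
  [set x | X x /\ ~ morse (fun y : 'rV[R]_m => g (row_mx x y))].

Definition cylinder (R : realType) (n m : nat) (X : set 'rV[R]_n) :
  set 'rV[R]_(n + m) := [set p | X (lsubmx p)].

Definition basic_semialgebraic (R : realType) (k : nat)
    (ps qs : seq (mpoly k R)) : set 'rV[R]_k :=
  [set v | (forall p, p \in ps -> meval (fun i => v 0 i) p = 0) /\
           (forall q, q \in qs -> 0 < meval (fun i => v 0 i) q)].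

Definition semialgebraic (R : realType) (k : nat) (A : set 'rV[R]_k) :=
  exists cs : seq (seq (mpoly k R) * seq (mpoly k R)),
    A = \bigcup_(c in [set` cs]) basic_semialgebraic c.1 c.2.

Definition graph_on (R : realType) (k : nat) (D : set 'rV[R]_k)
    (f : 'rV[R]_k -> R) : set 'rV[R]_(k + 1) :=
  [set w | D (lsubmx w) /\ rsubmx w = (f (lsubmx w))%:M].

Definition semialgebraic_on (R : realType) (k : nat) (D : set 'rV[R]_k)
    (f : 'rV[R]_k -> R) := semialgebraic (graph_on D f).

Definition box (R : realType) (n : nat) (a b : 'rV[R]_n) : set 'rV[R]_n :=
  [set x | forall i, a 0 i <= x 0 i <= b 0 i].

(* Lebesgue outer measure on [R^n]: infimum of the total volume of countable
   covers by boxes.  The index set [D] allows finite covers, which matters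
   only for [n = 0], where every box has volume 1. *)
Definition lebesgue_outer (R : realType) (n : nat) (A : set 'rV[R]_n) :
    \bar R :=
  ereal_inf [set s | exists (D : set nat) (a b : nat -> 'rV[R]_n),
    [/\ forall j i, a j 0 i <= b j 0 i,
        A `<=` \bigcup_(j in D) box (a j) (b j)
      & s = (\esum_(j in D) (\prod_(i < n) (b j 0 i - a j 0 i))%:E)%E]].

Definition ae_in (R : realType) (n : nat) (X : set 'rV[R]_n)
    (P : 'rV[R]_n -> Prop) :=
  lebesgue_outer [set x | X x /\ ~ P x] = 0%E.

(* The norm of ['rV[R]_n] in the library is the sup norm; the balls below are
   Euclidean. *)
Definition euclidean_ball (R : realType) (n : nat) (c : 'rV[R]_n) (r : R) :
    set 'rV[R]_n :=
  [set x | Num.sqrt (\sum_(i < n) (x 0 i - c 0 i) ^+ 2) <= r].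

(* [N(S, r)]; it is [+oo] when no finite cover exists. *)
Definition covering_number (R : realType) (n : nat) (S : set 'rV[R]_n)
    (r : R) : \bar R :=
  ereal_inf [set k%:R%:E | k in
    [set k : nat | exists c : 'I_k -> 'rV[R]_n,
      S `<=` \bigcup_i euclidean_ball (c i) r]].

(* [lne 0 = -oo], so the empty set has dimension [-oo]. *)
Definition upper_minkowski_dim (R : realType) (n : nat) (S : set 'rV[R]_n) :
    \bar R :=
  limf_esup (fun r : R => lne (covering_number S r) * ((- ln r)^-1)%:E)%E
    (0 : R)^'+.

(* Main.v *)
Require Import Defs.
From mathcomp Require Import all_boot all_order all_algebra.
From mathcomp Require Import all_classical all_reals all_analysis.
From mathcomp Require Import measurable_realfun.
From mathcomp Require Import polyorder polyrcf ordered_qelim.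
From mathcomp Require qe_rcf.
From mathcomp Require Import zify ring lra.
From mathcomp Require Import -(notations) mpoly.
Import Order.TTheory GRing.Theory Num.Theory.
Import numFieldNormedType.Exports.

Set Implicit Arguments.
Unset Strict Implicit.
Unset Printing Implicit Defensive.

Local Open Scope classical_set_scope.
Local Open Scope ring_scope.

(** The proof has two halves, one logical and one combinatorial.

    Being a degenerate critical point is a first-order condition on [g]:
    partial derivatives are limits, hence are described by epsilon-delta
    formulas over the real field.  Eliminating the quantifiers
    ([definable_ex]) shows that the bifurcation set is decided by the signs of
    finitely many polynomials ([definable_bifurcation_set],
    [definable_sign_determined]).  At a point where none of these polynomials
    vanishes, those that are identically zero left aside, all the signs are
    locally constant, so that a whole box around the point has the same status
    as the point.  A null set contains no box ([lebesgue_outer_box]), hence the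
    bifurcation set lies in the zero sets of finitely many nonzero polynomials
    ([null_definable_sub_zeros]).

    It remains to bound the number of small cubes met by the zero set of one
    nonzero polynomial [f] in [n] variables.  After rescaling, these cubes are
    the unit cells of [[0, K)^n], and the claim is that at most [C K^(n-1)] of
    them are met, where [C] depends only on [n] and on the partial degrees of
    [f] ([card_zero_cells]).  This goes by induction on the sum of the partial
    degrees.  Let [f] depend on two variables [x_i] and [x_c] at least, and let
    a cell contain a zero of [f].  If [f] has no zero on the two faces of the
    cell orthogonal to the axis [i], nor on one face orthogonal to the axis
    [c], then a path inside these faces joins the two ends of the segment
    parallel to the axis [i] through the zero, so [f] has the same sign at both
    ends, and [f] has a critical point along the segment: the cell is met by
    the zero set of the derivative of [f] along [x_i], whose degree is smaller
    ([zero_cells_critical]).  The cells with a zero on a face are counted with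
    the restrictions of [f] to the hyperplanes [x_i = j].  Such a restriction
    vanishes identically for few [j]; otherwise its zero set is a cylinder
    along the axis [i] that meets [C K^(n-1)] cells by induction, of which only
    the fraction [1 / K] in the slab next to the hyperplane matters
    ([card_face_cells]). *)

(** * Functions that are polynomial in each variable *)

Section Update.
Variables (T : Type) (n : nat).

Definition upd (x : 'I_n -> T) (i : 'I_n) (t : T) : 'I_n -> T :=
  fun j => if j == i then t else x j.

Lemma upd_same x i t : upd x i t i = t.
Proof. by rewrite /upd eqxx. Qed.

Lemma upd_neq x i t j : j != i -> upd x i t j = x j.
Proof. by rewrite /upd => /negbTE ->. Qed.

Lemma upd_id x i : upd x i (x i) = x.
Proof. by apply/funext => j; rewrite /upd; case: eqP => [->|]. Qed.

Lemma upd_upd x i s t : upd (upd x i s) i t = upd x i t.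
Proof. by apply/funext => j; rewrite /upd; case: eqP. Qed.

Lemma updC x i j s t : i != j -> upd (upd x i s) j t = upd (upd x j t) i s.
Proof.
move=> ij; apply/funext => k; rewrite /upd; case: (eqVneq k j) => // ->.
by rewrite eq_sym (negbTE ij).
Qed.

(** The coordinates of [x] are replaced by those of [y] one at a time. *)
Lemma eq_of_upd (S : Type) (f : ('I_n -> T) -> S) :
  (forall i x t, f (upd x i t) = f x) -> forall x y, f x = f y.
Proof.
move=> fE x y.
have fr (s : seq 'I_n) : f (foldr (fun i z => upd z i (y i)) x s) = f x.
  by elim: s => //= i s <-; rewrite fE.
rewrite -(fr (enum 'I_n)); congr f; apply/funext => j.
have : j \in enum 'I_n by rewrite mem_enum.
elim: (enum 'I_n) => //= i s IH; rewrite inE /upd.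
by case: eqP => [->|_ /=].
Qed.

End Update.

Section SepPoly.
Variables (R : realType) (n : nat).
Implicit Types (d : 'I_n -> nat) (f : ('I_n -> R) -> R) (x : 'I_n -> R).

(** A polynomial function, seen on the lines parallel to the axes.  Everything
    that the counting argument does to a polynomial is visible there:
    restricting it to a hyperplane, rescaling it, differentiating it in one
    variable.  The
    bound [d i] on the degree in [x_i] is the same on all lines parallel to the
    axis [i]. *)
Definition sep_poly d f := forall i x,
  exists2 q : {poly R}, (size q <= (d i).+1)%N & forall t, f (upd x i t) = q.[t].

(** The derivative along the axis [i], written by Lagrange interpolation on the
    line through [x] at the nodes [0, ..., d i].  A linear combination of values
    of [f] with coefficients that depend on [x i] only is visibly polynomial in
    the other variables. *)
Definition pderiv d i f : ('I_n -> R) -> R := fun x =>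
  \sum_(l < (d i).+1) f (upd x i l%:R) *
     (tnth ((d i).+1.-lagrange (fun k : nat => k%:R : R)) l : {poly R})^`().[x i].

Lemma natr_inj : injective (fun k : nat => k%:R : R).
Proof. by move=> a b /eqP; rewrite eqr_nat => /eqP. Qed.

Lemma pderivE d i f x (q : {poly R}) : (size q <= (d i).+1)%N ->
  (forall t, f (upd x i t) = q.[t]) ->
  forall t, pderiv d i f (upd x i t) = q^`().[t].
Proof.
move=> sq fq t.
rewrite (lagrange_gen (ltn0Sn _) natr_inj sq) raddf_sum horner_sum /=.
apply: eq_bigr => l _; rewrite upd_upd upd_same fq.
by rewrite derivM derivC mul0r add0r hornerM hornerC.
Qed.

(** Interpolation turns the derivative along the axis [i] into such a
    combination; hence its degree in the other variables is not larger than the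
    degree of [f]. *)
Lemma sep_poly_lincomb d i j f (m : nat) (u : 'I_m -> R) (c : 'I_m -> R) :
  i != j -> sep_poly d f -> forall x,
  exists2 q : {poly R}, (size q <= (d j).+1)%N &
    forall t, \sum_(l < m) f (upd (upd x j t) i (u l)) * c l = q.[t].
Proof.
move=> ij fd x.
have /choice[q qP] : forall l, exists q : {poly R}, (size q <= (d j).+1)%N /\
    forall t, f (upd (upd x j t) i (u l)) = q.[t].
  move=> l; have [q sq qE] := fd j (upd x i (u l)).
  by exists q; split=> // t; rewrite updC 1?eq_sym// qE.
exists (\sum_(l < m) (c l)%:P * q l).
  apply: (leq_trans (size_sum _ _ _)); apply/bigmax_leqP => l _.
  by rewrite mul_polyC (leq_trans (size_scale_leq _ _))//; case: (qP l).
move=> t; rewrite horner_sum; apply: eq_bigr => l _.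
by rewrite hornerM hornerC mulrC; case: (qP l) => _ ->.
Qed.

Lemma sep_poly_pderiv d i f : sep_poly d f ->
  sep_poly (upd d i (d i).-1) (pderiv d i f).
Proof.
move=> fd j x; case: (eqVneq j i) => [->|ji].
  have [q sq qE] := fd i x; exists q^`(); last exact: pderivE.
  rewrite upd_same; apply: leq_trans (leqSpred _).
  have [->|q0] := eqVneq q 0; first by rewrite deriv0 size_poly0.
  by rewrite -ltnS; exact: leq_trans (lt_size_deriv q0) sq.
have ij : i != j by rewrite eq_sym.
rewrite (upd_neq _ _ ji) /pderiv.
have [q sq qE] := @sep_poly_lincomb d i j f (d i).+1 (fun l => l%:R)
 (fun l => (tnth ((d i).+1.-lagrange (fun k : nat => k%:R : R)) l : {poly R})^`().[x i])
  ij fd x.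
by exists q => // t; rewrite -qE; apply: eq_bigr => l _; rewrite upd_neq.
Qed.
End SepPoly.

(** * Unit cells and their faces *)

Section Cells.
Variables (R : realType) (n K : nat).
Implicit Types (d : 'I_n -> nat) (f : ('I_n -> R) -> R) (x : 'I_n -> R).
Implicit Types (k : {ffun 'I_n -> 'I_K}).

(** Half-open, so that the cells indexed by [{0, ..., K-1}^n] partition
    [[0, K)^n]. *)
Definition cell k : set ('I_n -> R) :=
  [set x | forall i, (k i)%:R <= x i < (k i).+1%:R].

Definition zero_cells f : {set {ffun 'I_n -> 'I_K}} :=
  [set k | `[< exists2 x, cell k x & f x = 0 >]]%SET.

Lemma zero_cellsP f k :
  reflect (exists2 x, cell k x & f x = 0) (k \in zero_cells f).
Proof. by rewrite inE; exact: asboolP. Qed.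

Definition fupd k i a : {ffun 'I_n -> 'I_K} := [ffun j => upd k i a j].

Lemma fupd_upd k i a b : fupd (fupd k i a) i b = fupd k i b.
Proof.
apply/ffunP => j; rewrite !ffunE /upd; case: eqP => // ji.
by rewrite ffunE /upd; case: eqP.
Qed.

Lemma fupd_id k i : fupd k i (k i) = k.
Proof. by apply/ffunP => j; rewrite !ffunE upd_id. Qed.

(** [P] is a union of lines parallel to the axis [i], each of which has [K]
    cells, one of them in the slab [k i = j]. *)
Lemma card_slice (P : {set {ffun 'I_n -> 'I_K}}) i j :
  (forall k a, k \in P -> fupd k i a \in P) ->
  (K * #|[set k in P | k i == j]%SET| <= #|P|)%N.
Proof.
move=> Pi; rewrite -[X in (X * _)%N](card_ord K) -cardsT -cardsX.
pose A := finset.setX [set: 'I_K]%SET [set k in P | k i == j]%SET.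
rewrite -/A; pose phi (z : 'I_K * {ffun 'I_n -> 'I_K}) := fupd z.2 i z.1.
rewrite -(@card_in_imset _ _ phi A).
  apply/subset_leq_card/fintype.subsetP => _
    /imsetP[[a k] /setXP[_ /setIdP[/= kP _]] ->].
  exact: Pi.
move=> [a k] [b l]; rewrite !inE /= => /andP[_ /eqP kj] /andP[_ /eqP lj].
rewrite /phi /= => e.
have -> : a = b.
  by have := congr1 (fun g : {ffun _ -> _} => g i) e; rewrite !ffunE !upd_same.
by rewrite -[k](fupd_id _ i) -[l](fupd_id _ i) kj lj -(fupd_upd k i a) e fupd_upd.
Qed.

Lemma card_band i (J : {set 'I_K}) :
  (#|[set k : {ffun 'I_n -> 'I_K} | k i \in J]%SET| <= #|J| * K ^ n.-1)%N.
Proof.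
rewrite -sum1_card.
rewrite (partition_big (fun k : {ffun 'I_n -> 'I_K} => k i) (mem J)) /=; last first.
  by move=> k; rewrite inE.
rewrite -sum_nat_const; apply: leq_sum => j jJ.
have K0 : (0 < K)%N by case: (K) j {jJ} => [[]|].
rewrite -(leq_pmul2l K0) -expnS prednK; last by case: (n) i => [[]|].
apply: leq_trans (_ : #|[set: {ffun 'I_n -> 'I_K}]%SET| <= _)%N; last first.
  by rewrite cardsT card_ffun !card_ord.
apply: leq_trans (@card_slice [set: _]%SET i j _); last by move=> *; rewrite inE.
rewrite leq_mul2l sum1_card; apply/orP; right.
apply/subset_leq_card/fintype.subsetP => k.
by rewrite unfold_in !inE => /andP[].
Qed.

(** On the line through [x] parallel to the axis [i], [f] is a nonzero
    polynomial of degree at most [d i], and it vanishes where the line crosses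
    such a hyperplane. *)
Lemma card_vanishing_hyperplanes d f i (p : 'I_K -> R) x :
  injective p -> sep_poly d f -> f x != 0 ->
  (#|[set j | `[< forall y, f (upd y i (p j)) = 0%R >]]%SET| <= d i)%N.
Proof.
move=> pinj fd fx; have [q sq qE] := fd i x.
have q0 : q != 0.
  by apply: contraNneq fx => q0; rewrite -[x](upd_id _ i) qE q0 horner0.
set J := (X in #|X|); rewrite cardE -(size_map p) -ltnS.
apply: leq_trans sq; apply: max_poly_roots => //.
  apply/allP => _ /mapP[j + ->]; rewrite mem_enum inE => /asboolP jJ.
  by rewrite /root -qE jJ.
by rewrite map_inj_uniq // enum_uniq.
Qed.

(** With [p j = j] this is about the lower faces orthogonal to the axis [i], and
    with [p j = j + 1] about the upper ones. *)
Definition face_cells (p : 'I_K -> R) f i : {set {ffun 'I_n -> 'I_K}} :=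
  [set k | `[< exists2 x, cell k x & f (upd x i (p (k i))) = 0 >]]%SET.

Lemma cell_upd k x i t : cell k x -> (k i)%:R <= t < (k i).+1%:R ->
  cell k (upd x i t).
Proof. by move=> kx kt j; rewrite /upd; case: eqP => // ->. Qed.

(** Slabs next to a hyperplane on which [f] vanishes are few, and counted in
    full.  In any other slab [k i = j], the restriction of [f] to the hyperplane
    does not depend on [x_i], so the cells that its zero set meets are spread
    evenly over the [K] slabs orthogonal to the axis [i]; one slab has
    [C * K ^ n.-1 / K] of them, and the [K] slabs together [C * K ^ n.-1]. *)
Lemma card_face_cells d f i (p : 'I_K -> R) x (C : nat) :
  injective p -> sep_poly d f -> f x != 0 ->
  (forall j y, f (upd y i (p j)) != 0 ->
     (#|zero_cells (fun z => f (upd z i (p j)))| <= C * K ^ n.-1)%N) ->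
  (#|face_cells p f i| <= (d i + C) * K ^ n.-1)%N.
Proof.
move=> pinj fd fx fC.
pose J := [set j | `[< forall y, f (upd y i (p j)) = 0 >]]%SET.
have JC := @card_vanishing_hyperplanes d f i p x pinj fd fx.
pose A := [set k in face_cells p f i | k i \notin J]%SET.
apply: (@leq_trans (#|[set k : {ffun 'I_n -> 'I_K} | k i \in J]%SET| + #|A|)).
  apply: leq_trans (leq_card_setU _ _).1.
  apply/subset_leq_card/fintype.subsetP => k kf.
  by rewrite finset.in_setU [k \in A]finset.in_set kf finset.in_set orbN.
rewrite mulnDl leq_add//.
  by apply: leq_trans (card_band _ _) _; rewrite leq_mul2r JC orbT.
have [K0|K0] := posnP K.
  suff -> : A = finset.set0 by rewrite cards0.
  apply/finset.setP => k; have := ltn_ord (k i).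
  by rewrite ltnNge [X in (X <= _)%N]K0.
rewrite -sum1_card.
rewrite (partition_big (fun k : {ffun 'I_n -> 'I_K} => k i) (mem (~: J))) /=; last first.
  by move=> k; rewrite !inE => /andP[].
rewrite -(leq_pmul2l K0) big_distrr /=.
apply: (@leq_trans (\sum_(j in ~: J) (C * K ^ n.-1))%N); last first.
  rewrite sum_nat_const leq_mul2r; apply/orP; right.
  by rewrite -[leqRHS]card_ord max_card.
apply: leq_sum => j; rewrite !inE => /asboolPn /existsNP[y /eqP jy].
apply: leq_trans (fC _ _ jy).
apply: leq_trans (@card_slice _ i j _).
  rewrite leq_mul2l sum1_card; apply/orP; right.
  apply/subset_leq_card/fintype.subsetP => k.
  rewrite unfold_in !inE => /andP[/andP[/asboolP[z kz fz] _] /eqP kj].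
  by rewrite kj eqxx andbT; apply/asboolP; exists z => //; rewrite -kj.
move=> k a /zero_cellsP[z kz fz]; apply/zero_cellsP; exists (upd z i a%:R).
  move=> l; rewrite ffunE /upd; case: eqP => // _.
  by rewrite lexx /= ltr_nat.
by rewrite upd_upd.
Qed.
End Cells.

(** * Counting the cells met by a zero set *)

Section Count.
Variables (R : realType) (n : nat).
Implicit Types (d : 'I_n -> nat) (f : ('I_n -> R) -> R) (x : 'I_n -> R).

Lemma poly_same_sign (r : {poly R}) (u v : R) : u <= v ->
  (forall t, u <= t <= v -> r.[t] != 0) -> 0 < r.[u] * r.[v].
Proof.
move=> uv r0; rewrite ltNge; apply/negP => /(polyrcf.poly_ivt uv)[t tuv /rootP rt].
by move: (r0 t); rewrite rt eqxx => /(_ tuv).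
Qed.

(** The mean value theorem on both sides of the zero gives slopes of opposite
    signs. *)
Lemma poly_critical_point (q : {poly R}) (a x b : R) : a < x -> x < b ->
  q.[x] = 0 -> 0 < q.[a] * q.[b] -> exists2 t, a < t < b & q^`().[t] = 0.
Proof.
move=> ax xb qx qab.
have [s sax qs] := poly_mvt q ax; have [t txb qt] := poly_mvt q xb.
move: qs qt; rewrite qx sub0r subr0 => qs qt.
have [/andP[as_ sx] /andP[xt tb]] := (sax : a < s < x, txb : x < t < b).
have st : s <= t by rewrite ltW// (lt_trans sx).
have [|c] := @polyrcf.poly_ivt R q^`() s t st.
  rewrite -(@pmulr_rle0 _ ((x - a) * (b - x))); last by rewrite mulr_gt0 ?subr_gt0.
  rewrite mulrACA [_ * q^`().[s]]mulrC [_ * q^`().[t]]mulrC -qs -qt mulNr oppr_le0.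
  exact: ltW.
rewrite in_itv /= => /andP[sc ct] /rootP qc; exists c => //.
by rewrite (lt_le_trans as_ sc) (le_lt_trans ct tb).
Qed.

Lemma mul_gt0_trans (b a c : R) : 0 < a * b -> 0 < b * c -> 0 < a * c.
Proof.
move=> ab bc; have b0 : b != 0 by apply: contraTneq ab => ->; rewrite mulr0 ltxx.
have b2 : 0 < b * b by rewrite lt0r mulf_neq0 //= -expr2 sqr_ge0.
rewrite -(pmulr_rgt0 _ b2) (_ : b * b * (a * c) = (a * b) * (b * c)); last by ring.
exact: mulr_gt0.
Qed.

Lemma sep_poly0_const d f i : d i = 0%N -> sep_poly d f ->
  forall x t, f (upd x i t) = f x.
Proof.
move=> di fd x t; have [q] := fd i x; rewrite di => /size1_polyC -> qE.
by rewrite qE -[in RHS](upd_id x i) qE !hornerC.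
Qed.

Lemma sep_poly_restrict d f i a : sep_poly d f ->
  sep_poly (upd d i 0%N) (fun x => f (upd x i a)).
Proof.
move=> fd j x; case: (eqVneq j i) => [->|ji].
  exists (f (upd x i a))%:P => [|t]; last by rewrite upd_upd hornerC.
  by rewrite (leq_trans (size_polyC_leq1 _)).
have [q sq qE] := fd j (upd x i a); exists q; first by rewrite upd_neq.
by move=> t; rewrite updC // qE.
Qed.

Lemma sum_upd_lt d i a : (a < d i)%N -> (\sum_j upd d i a j < \sum_j d j)%N.
Proof.
move=> ad; rewrite (bigD1 i)//= [ltnRHS](bigD1 i)//= upd_same -addSn leq_add//.
by rewrite leq_eqVlt; apply/orP; left; apply/eqP/eq_bigr => j ji; rewrite upd_neq.
Qed.

(** The sign of [f] does not change along the path that leaves the lower face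
    [x_i = k i] at the foot of the zero, follows this face in the direction [c]
    down to the face [x_c = k c], crosses the cell inside that face in the
    direction [i], and comes back in the direction [c] along the upper face
    orthogonal to [i].  The segment through the zero in the direction [i] joins
    the two ends of this path, so Rolle's theorem in the form
    [poly_critical_point] applies to it. *)
Lemma zero_cells_critical K d f i c k : i != c -> sep_poly d f ->
  k \in zero_cells K f ->
  k \notin face_cells (fun j : 'I_K => j%:R) f i ->
  k \notin face_cells (fun j : 'I_K => j.+1%:R) f i ->
  k \notin face_cells (fun j : 'I_K => j%:R) f c ->
  k \in zero_cells K (pderiv d i f).
Proof.
move=> ic fd /zero_cellsP[x kx fx].
rewrite !inE => /asboolPn lo /asboolPn hi /asboolPn clo.
have flo y : cell k y -> f (upd y i (k i)%:R) != 0.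
  by move=> ky; apply/eqP => fy; apply: lo; exists y.
have fhi y : cell k y -> f (upd y i (k i).+1%:R) != 0.
  by move=> ky; apply/eqP => fy; apply: hi; exists y.
have fclo y : cell k y -> f (upd y c (k c)%:R) != 0.
  by move=> ky; apply/eqP => fy; apply: clo; exists y.
set a := (k i)%:R in flo *; set b := (k i).+1%:R in fhi *.
set c0 := (k c)%:R in fclo *.
have [q sq qE] := fd i x.
have qx : q.[x i] = 0 by rewrite -qE upd_id.
have ax : a < x i.
  have /andP[] := kx i; rewrite le_eqVlt => /orP[/eqP e _|//].
  by move: (flo _ kx); rewrite qE /a e qx eqxx.
have xb : x i < b by have /andP[] := kx i.
have /andP[c0x xc1] := kx c.
have ab : a <= b by rewrite ltW// (lt_trans ax).
have kc t : c0 <= t <= x c -> cell k (upd x c t).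
  by move=> /andP[ct tc]; apply: cell_upd => //; rewrite ct (le_lt_trans tc).
(* The two pieces of the path along the faces orthogonal to the axis [i]. *)
have side s : (forall y, cell k y -> f (upd y i s) != 0) ->
    0 < f (upd x i s) * f (upd (upd x c c0) i s).
  move=> fs; have [r sr rE] := fd c (upd x i s).
  have e t : r.[t] = f (upd (upd x c t) i s) by rewrite updC 1?eq_sym // rE.
  have := @poly_same_sign r c0 (x c) c0x; rewrite !e upd_id mulrC; apply => t tc.
  by rewrite e; apply: fs; apply: kc.
have [|t /andP[at_ tb] qt] := poly_critical_point ax xb qx.
  rewrite -!qE; apply: mul_gt0_trans (side _ flo) _.
  rewrite mulrC; apply: mul_gt0_trans (side _ fhi) _; rewrite mulrC.
  have [r sr rE] := fd i (upd x c c0).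
  rewrite !rE; apply: poly_same_sign => // t /andP[at_]; rewrite le_eqVlt.
  rewrite -rE => /orP[/eqP ->|tb]; first by apply/fhi/kc; rewrite lexx c0x.
  rewrite updC; last by rewrite eq_sym.
  apply: fclo; apply: cell_upd => //.
  by rewrite at_ tb.
exists (upd x i t); last by rewrite (pderivE sq qE t).
by apply: cell_upd => //; rewrite (ltW at_) tb.
Qed.

Lemma horner_eq0 (q : {poly R}) : (forall t, q.[t] = 0) -> q = 0.
Proof.
move=> q0; apply: contraTeq isT => qn0.
have := @max_poly_roots _ q [seq k%:R | k <- iota 0 (size q)] qn0.
rewrite size_map size_iota ltnn => h; exfalso; apply: notF; apply: h.
  by apply/allP => t _; rewrite /root q0.
by rewrite map_inj_uniq ?iota_uniq //; exact: natr_inj.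
Qed.

(** The cells of the line that contain a root are disjoint, so that they
    contain distinct roots. *)
Lemma card_root_cells K (q : {poly R}) (m : nat) : q != 0 -> (size q <= m.+1)%N ->
  (#|[set j : 'I_K | `[< exists2 t : R, (j%:R <= t < j.+1%:R)%R
                                      & q.[t] = 0%R >]]%SET| <= m)%N.
Proof.
move=> q0 sq; set J := (X in #|X|).
have /choice[r rP] : forall j : 'I_K, exists t : R,
    j \in J -> (j%:R <= t < j.+1%:R) /\ q.[t] = 0.
  move=> j; case: (boolP (j \in J)); last by exists 0.
  by rewrite inE => /asboolP[t tj qt]; exists t.
rewrite cardE -(size_map r) -ltnS.
apply: leq_trans sq; apply: max_poly_roots => //.
  by apply/allP => _ /mapP[j + ->]; rewrite mem_enum => /rP[_ qr]; rewrite /root qr.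
rewrite map_inj_in_uniq ?enum_uniq // => j l; rewrite !mem_enum.
move=> /rP[/andP[j1 j2] _] /rP[/andP[l1 l2] _] e; apply/val_inj/eqP.
rewrite -e in l1 l2; move: (le_lt_trans j1 l2) (le_lt_trans l1 j2).
by rewrite !ltr_nat !ltnS eqn_leq => -> ->.
Qed.

Lemma card_zero_cells_none K f : (forall x, f x != 0) -> #|zero_cells K f| = 0%N.
Proof.
move=> f0; apply/eqP; rewrite cards_eq0; apply/eqP/finset.setP => k.
rewrite finset.in_set0; apply/negP => /zero_cellsP[x _ fx].
by move: (f0 x); rewrite fx eqxx.
Qed.

(** The constant [C] does not depend on [f] itself.  This uniformity is what
    makes the induction work, as it is applied to all the restrictions of [f] to
    hyperplanes, and what allows rescaling [f] in [zeros_cover]. *)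
Theorem card_zero_cells (D : nat) : exists C : nat, forall d f K,
  (\sum_i d i <= D)%N -> sep_poly d f -> (exists x, f x != 0) ->
  (#|zero_cells K f| <= C * K ^ n.-1)%N.
Proof.
elim: D => [|D [C IH]].
  exists 0%N => d f K; rewrite leqn0 sum_nat_eq0 => /forallP /= d0 fd [x fx].
  rewrite card_zero_cells_none // => y.
  by rewrite (eq_of_upd (fun i => sep_poly0_const (eqP (d0 i)) fd) y x).
exists (3 * (D.+1 + C) + C + D.+1)%N => d f K dD fd [x fx].
have small d' f' : (\sum_i d' i < \sum_i d i)%N -> sep_poly d' f' ->
    (exists x, f' x != 0) -> (#|zero_cells K f'| <= C * K ^ n.-1)%N.
  by move=> dd; apply: IH; rewrite -ltnS; exact: leq_trans dD.
have dleD i : (d i <= D.+1)%N.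
  by apply: leq_trans dD; rewrite (bigD1 i)//= leq_addr.
have [d0|] := pselect (forall i, d i = 0%N).
  rewrite card_zero_cells_none // => y.
  by rewrite (eq_of_upd (fun i => sep_poly0_const (d0 i) fd) y x).
move=> /existsNP[i /eqP]; rewrite -lt0n => di.
(* If the derivative along the axis [i] vanishes identically, [f] does not
   depend on [x_i], and the bound on its degree in [x_i] can be lowered to 0. *)
have [pf0|] := pselect (forall y, pderiv d i f y = 0).
  apply: leq_trans (small (upd d i 0%N) f _ _ _) _; first exact: sum_upd_lt.
  - move=> j y; case: (eqVneq j i) => [->|ji]; rewrite /upd; last first.
      by rewrite (negbTE ji); exact: fd.
    rewrite eqxx; have [q sq qE] := fd i y; exists q => //.
    have q'0 : q^`() = 0 by apply: horner_eq0 => t; rewrite -(pderivE sq qE).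
    by have := size_deriv q; rewrite q'0 size_poly0; case: (size q) => [|[]].
  - by exists x.
  - by rewrite leq_mul2r; apply/orP; right; lia.
move=> /existsNP[y /eqP pfy].
have [[c [ci dc]]|] := pselect (exists c, c != i /\ (0 < d c)%N).
  have face l (p : 'I_K -> R) : injective p -> (0 < d l)%N ->
      (#|face_cells p f l| <= (D.+1 + C) * K ^ n.-1)%N.
    move=> pinj dl; apply: leq_trans (@card_face_cells _ _ _ d f l p x C pinj fd fx _) _.
      move=> j z fz; apply: (small (upd d l 0%N)); first exact: sum_upd_lt.
        exact: sep_poly_restrict.
      by exists z.
    by rewrite leq_mul2r leq_add2r dleD orbT.
  have crit : (#|zero_cells K (pderiv d i f)| <= C * K ^ n.-1)%N.
    apply: (small (upd d i (d i).-1)); first by apply: sum_upd_lt; rewrite prednK.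
      exact: sep_poly_pderiv.
    by exists y.
  have lo_inj : injective (fun j : 'I_K => j%:R : R).
    by move=> j l /natr_inj/val_inj.
  have hi_inj : injective (fun j : 'I_K => j.+1%:R : R).
    by move=> j l /natr_inj[] /val_inj.
  set F1 := face_cells (fun j : 'I_K => j%:R) f i.
  set F2 := face_cells (fun j : 'I_K => j.+1%:R) f i.
  set F3 := face_cells (fun j : 'I_K => j%:R) f c.
  apply: (@leq_trans #|F1 :|: (F2 :|: (F3 :|: zero_cells K (pderiv d i f)))|).
    apply/subset_leq_card/fintype.subsetP => k kf.
    rewrite !finset.in_setU; case: (boolP (k \in F1)) => //= k1.
    case: (boolP (k \in F2)) => //= k2; case: (boolP (k \in F3)) => //= k3.
    by apply: (zero_cells_critical _ fd kf k1 k2 k3); rewrite eq_sym.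
  apply: leq_trans (leq_card_setU _ _).1 _.
  rewrite -addnA mulnDl mulnDl; set Kn := (K ^ n.-1)%N in face crit *.
  have U2 := (leq_card_setU F2 (F3 :|: zero_cells K (pderiv d i f))).1.
  have U3 := (leq_card_setU F3 (zero_cells K (pderiv d i f))).1.
  have := face i _ lo_inj di; have := face i _ hi_inj di.
  have := face c _ lo_inj dc.
  rewrite -/F1 -/F2 -/F3; nia.
(* Here [f] depends on [x_i] only, and no path goes around its zeros; but the
   cells met by its zero set fill slabs over the roots of one polynomial. *)
move=> /forallNP noc.
have [q sq qE] := fd i x.
have fq z : f z = q.[z i].
  rewrite -qE -[in LHS](upd_id z i).
  apply: (eq_of_upd (f := fun w => f (upd w i (z i)))) => j w t.
  case: (eqVneq j i) => [->|ji]; first by rewrite upd_upd.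
  rewrite updC // (sep_poly0_const _ fd) //.
  by apply/eqP; rewrite -leqn0 leqNgt; apply/negP => dj; apply: (noc j).
have q0 : q != 0 by apply: contraNneq fx => q0; rewrite fq q0 horner0.
have JC := card_root_cells K q0 sq; set J := finset _ in JC.
apply: (@leq_trans (#|J| * K ^ n.-1)%N).
  apply: leq_trans (card_band i J); apply/subset_leq_card/fintype.subsetP => k.
  move=> /zero_cellsP[z kz]; rewrite fq => qz; rewrite !inE.
  by exists (z i).
rewrite leq_mul2r; apply/orP; right; apply: leq_trans JC _.
by apply: leq_trans (dleD i) _; rewrite leq_addl.
Qed.
End Count.

(** * Polynomial functions and polynomial maps *)

(** A type whose elements are described by a fixed number of real coordinates.
    Formulas see only the list of the coordinates, while statements are about
    row vectors, pairs and tuples of them. *)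
Class coordinates (R E : Type) := Coordinates {
  cdim : nat;
  coords : E -> seq R;
  size_coords : forall e, size (coords e) = cdim }.

#[export] Instance coordinates_scalar (R : realType) : coordinates R R.
Proof. exact: (@Coordinates R R 1%N (fun t => [:: t])). Defined.

#[export] Instance coordinates_row (R : realType) n : coordinates R 'rV[R]_n.
Proof.
refine (@Coordinates R _ n (fun x : 'rV[R]_n => [seq x 0 i | i <- enum 'I_n]) _).
by move=> x; rewrite size_map size_enum_ord.
Defined.

#[export] Instance coordinates_prod (R : realType) E F
    `{coordinates R E} `{coordinates R F} :
  coordinates R (E * F).
Proof.
refine (@Coordinates R (E * F) (cdim (E := E) + cdim (E := F))%N
  (fun e => coords e.1 ++ coords e.2) _).
by move=> e; rewrite size_cat !size_coords.
Defined.

Section Polynomial.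
Variables (R : realType) (E : Type) (cE : coordinates R E).
Implicit Types f g : E -> R.

(** Terms may contain inverses; [rterm] leaves out those that do. *)
Definition polyfun f := exists2 t : GRing.term R, GRing.rterm t &
  forall e, f e = GRing.eval (coords e) t.

Lemma eq_polyfun f g : (forall e, g e = f e) -> polyfun f -> polyfun g.
Proof. by move=> fg [t rt fE]; exists t => // e; rewrite fg. Qed.

Lemma polyfun_coord i : polyfun (fun e => (coords e)`_i).
Proof. by exists (GRing.Var _ i). Qed.

Lemma polyfun_cst c : polyfun (fun=> c).
Proof. by exists (GRing.Const c). Qed.

Lemma polyfunD f g : polyfun f -> polyfun g -> polyfun (fun e => f e + g e).
Proof.
move=> [s rs fE] [t rt gE].
by exists (GRing.Add s t) => [|e] /=; rewrite ?rs // fE gE.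
Qed.

Lemma polyfunM f g : polyfun f -> polyfun g -> polyfun (fun e => f e * g e).
Proof.
move=> [s rs fE] [t rt gE].
by exists (GRing.Mul s t) => [|e] /=; rewrite ?rs // fE gE.
Qed.

Lemma polyfunN f : polyfun f -> polyfun (fun e => - f e).
Proof. by move=> [s rs fE]; exists (GRing.Opp s) => // e /=; rewrite fE. Qed.

Lemma polyfunMn f m : polyfun f -> polyfun (fun e => f e *+ m).
Proof. by move=> [s rs fE]; exists (GRing.NatMul s m) => // e /=; rewrite fE. Qed.

Lemma polyfunX f m : polyfun f -> polyfun (fun e => f e ^+ m).
Proof. by move=> [s rs fE]; exists (GRing.Exp s m) => // e /=; rewrite fE. Qed.

Lemma polyfunB f g : polyfun f -> polyfun g -> polyfun (fun e => f e - g e).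
Proof. by move=> pf pg; apply: polyfunD => //; exact: polyfunN. Qed.

Lemma polyfun_sum (T : Type) (r : seq T) (P : pred T) (F : T -> E -> R) :
  (forall i, polyfun (F i)) -> polyfun (fun e => \sum_(i <- r | P i) F i e).
Proof.
move=> pF; elim: r => [|i r IH].
  by apply: eq_polyfun (polyfun_cst 0) => e; rewrite big_nil.
apply: (eq_polyfun (f := fun e =>
    (if P i then F i e else 0) + \sum_(j <- r | P j) F j e)) => [e|].
  by rewrite big_cons; case: (P i); rewrite ?add0r.
by apply: polyfunD => //; case: (P i) => //; exact: polyfun_cst.
Qed.

Lemma polyfun_prod (T : Type) (r : seq T) (P : pred T) (F : T -> E -> R) :
  (forall i, polyfun (F i)) -> polyfun (fun e => \prod_(i <- r | P i) F i e).
Proof.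
move=> pF; elim: r => [|i r IH].
  by apply: eq_polyfun (polyfun_cst 1) => e; rewrite big_nil.
apply: (eq_polyfun (f := fun e =>
    (if P i then F i e else 1) * \prod_(j <- r | P j) F j e)) => [e|].
  by rewrite big_cons; case: (P i); rewrite ?mul1r.
by apply: polyfunM => //; case: (P i) => //; exact: polyfun_cst.
Qed.

End Polynomial.
Arguments polyfun {R E cE}.

Section PolynomialMap.
Variable R : realType.

Definition polymap E F {cE : coordinates R E} {cF : coordinates R F} (phi : E -> F) :=
  forall i, polyfun (fun e => (coords (phi e))`_i).

Lemma polyfun_comp E F (cE : coordinates R E) (cF : coordinates R F)
    (phi : E -> F) (f : F -> R) :
  polymap phi -> polyfun f -> polyfun (fun e => f (phi e)).
Proof.
move=> pphi [t rt fE].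
have -> : (fun e => f (phi e)) = (fun e => GRing.eval (coords (phi e)) t).
  by apply/funext => e /=.
elim: t rt {fE} => /=.
- by move=> i _; exact: pphi.
- by move=> c _; exact: polyfun_cst.
- by move=> k _; exact: polyfun_cst.
- by move=> s IHs t IHt /andP[/IHs ps /IHt pt]; exact: polyfunD.
- by move=> t IH /IH pt; exact: polyfunN.
- by move=> t IH k /IH pt; exact: polyfunMn.
- by move=> s IHs t IHt /andP[/IHs ps /IHt pt]; exact: polyfunM.
- by [].
- by move=> t IH k /IH pt; exact: polyfunX.
Qed.

Lemma polyfun_scalar : polyfun (fun t : R => t).
Proof. exact: (polyfun_coord _ 0). Qed.

Lemma polyfun_entry n (i : 'I_n) : polyfun (fun x : 'rV[R]_n => x 0 i).
Proof.
apply: eq_polyfun (polyfun_coord (coordinates_row R n) i) => x /=.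
by rewrite (nth_map i) ?size_enum_ord // nth_ord_enum.
Qed.

Lemma polymap_id E (cE : coordinates R E) : polymap (fun e : E => e).
Proof. by move=> i; exact: polyfun_coord. Qed.

Lemma polymap_comp E F G (cE : coordinates R E) (cF : coordinates R F)
    (cG : coordinates R G) (phi : E -> F) (psi : F -> G) :
  polymap phi -> polymap psi -> polymap (fun e => psi (phi e)).
Proof. by move=> pphi ppsi i; exact: polyfun_comp (ppsi i). Qed.

Lemma polymap_pair E F G (cE : coordinates R E) (cF : coordinates R F)
    (cG : coordinates R G) (phi : E -> F) (psi : E -> G) :
  polymap phi -> polymap psi -> polymap (fun e => (phi e, psi e)).
Proof.
move=> pphi ppsi i; case: (ltnP i (cdim (E := F))) => iF.
  by apply: eq_polyfun (pphi i) => e /=; rewrite nth_cat size_coords iF.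
apply: eq_polyfun (ppsi (i - cdim (E := F))%N) => e /=.
by rewrite nth_cat size_coords ltnNge iF.
Qed.

Lemma polymap_proj1 E F (cE : coordinates R E) (cF : coordinates R F) :
  polymap (fun e : E * F => e.1).
Proof.
move=> i; case: (ltnP i (cdim (E := E))) => iE.
  apply: eq_polyfun (polyfun_coord (@coordinates_prod R E F cE cF) i) => e /=.
  by rewrite nth_cat size_coords iE.
by apply: eq_polyfun (polyfun_cst _ 0) => e; rewrite nth_default // size_coords.
Qed.

Lemma polymap_proj2 E F (cE : coordinates R E) (cF : coordinates R F) :
  polymap (fun e : E * F => e.2).
Proof.
move=> i.
apply: eq_polyfun (polyfun_coord (@coordinates_prod R E F cE cF)
  (cdim (E := E) + i)) => e /=.
by rewrite nth_cat size_coords ltnNge leq_addr /= addKn.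
Qed.

Lemma polymap_fst E F G (cE : coordinates R E) (cF : coordinates R F)
    (cG : coordinates R G) (phi : G -> E * F) :
  polymap phi -> polymap (fun z => (phi z).1).
Proof. by move=> pphi; exact: polymap_comp pphi (@polymap_proj1 _ _ _ _). Qed.

Lemma polymap_snd E F G (cE : coordinates R E) (cF : coordinates R F)
    (cG : coordinates R G) (phi : G -> E * F) :
  polymap phi -> polymap (fun z => (phi z).2).
Proof. by move=> pphi; exact: polymap_comp pphi (@polymap_proj2 _ _ _ _). Qed.

Lemma polyfun_pmap E (cE : coordinates R E) (f : E -> R) : polymap f -> polyfun f.
Proof. by move=> pf; exact: polyfun_comp pf polyfun_scalar. Qed.

Lemma polymap_scalar E (cE : coordinates R E) (f : E -> R) : polyfun f -> polymap f.
Proof. by move=> pf [|i] //=; rewrite nth_nil; exact: polyfun_cst. Qed.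

Lemma polymap_row E (cE : coordinates R E) n (phi : E -> 'rV[R]_n) :
  (forall i, polyfun (fun e => phi e 0 i)) -> polymap phi.
Proof.
move=> pphi i; case: (ltnP i n) => i_n.
  apply: eq_polyfun (pphi (Ordinal i_n)) => e /=.
  by rewrite (nth_map (Ordinal i_n)) ?size_enum_ord // (nth_ord_enum _ (Ordinal i_n)).
by apply: eq_polyfun (polyfun_cst _ 0) => e; rewrite nth_default // size_coords.
Qed.

Lemma polyfun_row E (cE : coordinates R E) n (phi : E -> 'rV[R]_n) i :
  polymap phi -> polyfun (fun e => phi e 0 i).
Proof. by move=> pphi; exact: polyfun_comp (polyfun_entry i). Qed.

Lemma polymap_row_mx E (cE : coordinates R E) n m
    (phi : E -> 'rV[R]_n) (psi : E -> 'rV[R]_m) :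
  polymap phi -> polymap psi -> polymap (fun e => row_mx (phi e) (psi e)).
Proof.
move=> pphi ppsi; apply: polymap_row => i; rewrite -(splitK i).
case: (fintype.split i) => j /=.
  by apply: eq_polyfun (polyfun_row j pphi) => e; rewrite row_mxEl.
by apply: eq_polyfun (polyfun_row j ppsi) => e; rewrite row_mxEr.
Qed.

Lemma polymap_lsubmx E (cE : coordinates R E) n m (phi : E -> 'rV[R]_(n + m)) :
  polymap phi -> polymap (fun e => lsubmx (phi e)).
Proof.
move=> pphi; apply: polymap_row => i.
apply: eq_polyfun (polyfun_row (lshift m i) pphi) => e.
by rewrite mxE.
Qed.

Lemma polymap_scalar_mx E (cE : coordinates R E) (f : E -> R) :
  polyfun f -> polymap (fun e => (f e)%:M : 'rV[R]_1).
Proof.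
move=> pf; apply: polymap_row => i; apply: eq_polyfun pf => e.
by rewrite ord1 mxE eqxx.
Qed.

Lemma polyfun_meval n (p : mpoly n R) :
  polyfun (fun v : 'rV[R]_n => meval (fun i => v 0 i) p).
Proof.
rewrite (_ : (fun v => _) = fun v : 'rV[R]_n =>
  \sum_(m <- msupp p) mcoeff m p * \prod_i v 0 i ^+ m i).
  apply: polyfun_sum => m; apply: polyfunM; first exact: polyfun_cst.
  by apply: polyfun_prod => i; apply: polyfunX; exact: polyfun_entry.
by apply/funext => v; rewrite mevalE.
Qed.

End PolynomialMap.
Arguments polymap {R E F cE cF}.

Ltac polymap_proj :=
  repeat first [ exact: polymap_id | apply: polymap_fst | apply: polymap_snd ].

(** * Definable sets and quantifier elimination *)

Section Semialgebraic.
Variable R : realType.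

(** Definable without quantifiers over the real field with parameters; the
    definable subsets of [R^n] are its semialgebraic subsets. *)
Definition definable E {cE : coordinates R E} (P : E -> Prop) :=
  exists2 f : ord.formula R, ord.qf_form f && ord.rformula f &
    forall e, P e <-> ord.holds (coords e) f.

Lemma eq_definable E (cE : coordinates R E) (P Q : E -> Prop) :
  (forall e, Q e <-> P e) -> definable P -> definable Q.
Proof.
by move=> PQ [f qf Pf]; exists f => // e; rewrite PQ Pf.
Qed.

Section Closure.
Variables (E : Type) (cE : coordinates R E).
Implicit Types (P Q : E -> Prop) (f g : E -> R).

Lemma definable_cst (A : Prop) : definable (fun _ : E => A).
Proof. by exists (ord.Bool `[< A >]) => // e /=; split => /asboolP. Qed.

Lemma definable_not P : definable P -> definable (fun e => ~ P e).
Proof. by move=> [f ff Pf]; exists (ord.Not f) => // e /=; rewrite Pf. Qed.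

Lemma definable_and P Q : definable P -> definable Q -> definable (fun e => P e /\ Q e).
Proof.
move=> [f /andP[f1 f2] Pf] [g /andP[g1 g2] Qg]; exists (ord.And f g) => /=.
  by rewrite f1 f2 g1 g2.
by move=> e; rewrite Pf Qg.
Qed.

Lemma definable_or P Q : definable P -> definable Q -> definable (fun e => P e \/ Q e).
Proof.
move=> [f /andP[f1 f2] Pf] [g /andP[g1 g2] Qg]; exists (ord.Or f g) => /=.
  by rewrite f1 f2 g1 g2.
by move=> e; rewrite Pf Qg.
Qed.

Lemma definable_imp P Q : definable P -> definable Q -> definable (fun e => P e -> Q e).
Proof.
move=> [f /andP[f1 f2] Pf] [g /andP[g1 g2] Qg]; exists (ord.Implies f g) => /=.
  by rewrite f1 f2 g1 g2.
by move=> e; rewrite Pf Qg.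
Qed.

Lemma definable_eq f g : polyfun f -> polyfun g -> definable (fun e => f e = g e).
Proof.
move=> [s rs fE] [t rt gE]; exists (ord.Equal s t) => /=; first by rewrite rs rt.
by move=> e; rewrite fE gE.
Qed.

Lemma definable_le f g : polyfun f -> polyfun g -> definable (fun e => f e <= g e).
Proof.
move=> [s rs fE] [t rt gE]; exists (ord.Le s t) => /=; first by rewrite rs rt.
by move=> e; rewrite fE gE.
Qed.

Lemma definable_lt f g : polyfun f -> polyfun g -> definable (fun e => f e < g e).
Proof.
move=> [s rs fE] [t rt gE]; exists (ord.Lt s t) => /=; first by rewrite rs rt.
by move=> e; rewrite fE gE.
Qed.

Lemma definable_all_in (T : eqType) (s : seq T) (P : T -> E -> Prop) :
  (forall i, definable (P i)) -> definable (fun e => forall i, i \in s -> P i e).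
Proof.
move=> saP; elim: s => [|i s IH].
  by apply: eq_definable (definable_cst True) => e.
apply: eq_definable (definable_and (saP i) IH) => e; split => [h|[hi hs] j].
  by split=> [|j js]; apply: h; rewrite inE ?eqxx ?js ?orbT.
by rewrite inE => /predU1P[->|/hs].
Qed.

Lemma definable_has_in (T : eqType) (s : seq T) (P : T -> E -> Prop) :
  (forall i, definable (P i)) -> definable (fun e => exists2 i, i \in s & P i e).
Proof.
move=> saP; elim: s => [|i s IH].
  by apply: eq_definable (definable_cst False) => e; split => // -[].
apply: eq_definable (definable_or (saP i) IH) => e; split => [[j]|[hi|[j js hj]]].
- by rewrite inE => /predU1P[->|js] h; [left|right; exists j].
- by exists i; rewrite // inE eqxx.
- by exists j; rewrite // inE js orbT.
Qed.

Lemma definable_forall_fin (I : finType) (P : I -> E -> Prop) :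
  (forall i, definable (P i)) -> definable (fun e => forall i, P i e).
Proof.
move=> /(@definable_all_in _ (enum I)); apply: eq_definable => e.
by split=> [h i _|h i]; [exact: h|apply: h; rewrite mem_enum].
Qed.

End Closure.

(** Induction on the formula: since there are no quantifiers, only atoms are
    changed, and [polyfun_comp] deals with them. *)
Lemma definable_comp E F (cE : coordinates R E) (cF : coordinates R F)
    (phi : E -> F) (P : F -> Prop) :
  polymap phi -> definable P -> definable (fun e => P (phi e)).
Proof.
move=> pphi [f qf Pf].
apply: eq_definable (_ : definable (fun e => ord.holds (coords (phi e)) f)) => [e|].
  exact: Pf.
have term t : GRing.rterm t -> polyfun (fun e => GRing.eval (coords (phi e)) t).
  move=> rt; apply: (@polyfun_comp _ _ _ _ _ phi (fun e => GRing.eval (coords e) t)) => //.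
  by exists t.
elim: f qf {Pf} => //=.
- by move=> b _; exact: definable_cst.
- by move=> s t /andP[rs rt]; apply: definable_eq; exact: term.
- by move=> s t /andP[rs rt]; apply: definable_lt; exact: term.
- by move=> s t /andP[rs rt]; apply: definable_le; exact: term.
- move=> f IHf g IHg /andP[/andP[? ?] /andP[? ?]].
  by apply: definable_and; [apply: IHf|apply: IHg]; apply/andP.
- move=> f IHf g IHg /andP[/andP[? ?] /andP[? ?]].
  by apply: definable_or; [apply: IHf|apply: IHg]; apply/andP.
- move=> f IHf g IHg /andP[/andP[? ?] /andP[? ?]].
  by apply: definable_imp; [apply: IHf|apply: IHg]; apply/andP.
- by move=> f IHf qf; apply: definable_not; apply: IHf.
Qed.

(** The Tarski-Seidenberg theorem: quantifier elimination for real closed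
    fields, applied to the formula that quantifies over the last coordinate. *)
Lemma definable_ex E (cE : coordinates R E) (P : E -> R -> Prop) :
  definable (fun z : E * R => P z.1 z.2) -> definable (fun e => exists t, P e t).
Proof.
move=> [f /andP[qf rf] Pf]; pose g := ord.Exists (@cdim R E cE) f.
have rg : ord.rformula g by [].
pose wp i bc := qe_rcf.qfr_to_formula (@qe_rcf.wproj R i bc).
have wf := @qe_rcf.wf_QE_wproj R.
have val := @qe_rcf.valid_QE_wproj R.
have wfq := ord.quantifier_elim_wf wf rg.
exists (ord.quantifier_elim wp g) => // e.
have [qg _] := andP wfq.
split=> [[t /(Pf (e, t)) Pt]|].
  apply/(ord.qf_evalP _ qg)/(ord.quantifier_elim_rformP wf val (coords e) rg) => /=.
  exists t; apply: ord.eq_holds Pt => i.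
  rewrite nth_set_nth /= nth_cat size_coords.
  case: ltnP => [iE|]; first by rewrite ltn_eqF.
  rewrite leq_eqVlt => /predU1P[<-|iE]; first by rewrite subnn eqxx.
  by rewrite gtn_eqF // !nth_default // ?size_coords ?(ltnW iE) // subn_gt0.
move/(ord.qf_evalP _ qg)/(ord.quantifier_elim_rformP wf val (coords e) rg) => /= -[t Pt].
exists t; apply/(Pf (e, t)); apply: ord.eq_holds Pt => i.
rewrite nth_set_nth /= nth_cat size_coords.
case: ltnP => [iE|]; first by rewrite ltn_eqF.
rewrite leq_eqVlt => /predU1P[<-|iE]; first by rewrite subnn eqxx.
by rewrite gtn_eqF // !nth_default // ?size_coords ?(ltnW iE) // subn_gt0.
Qed.

Lemma definable_forall E (cE : coordinates R E) (P : E -> R -> Prop) :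
  definable (fun z : E * R => P z.1 z.2) -> definable (fun e => forall t, P e t).
Proof.
move=> /definable_not saP.
apply: eq_definable (definable_not (definable_ex (P := fun e t => ~ P e t) saP)) => e.
split=> [h [t /(_ (h t))]//|h t].
by apply: contrapT => Pt; apply: h; exists t.
Qed.

Lemma definable_ex_row m E (cE : coordinates R E) (P : E -> 'rV[R]_m -> Prop) :
  definable (fun z : E * 'rV[R]_m => P z.1 z.2) -> definable (fun e => exists y, P e y).
Proof.
elim: m E cE P => [|m IH] E cE P saP.
  apply: eq_definable (definable_comp (_ : polymap (fun e => (e, 0))) saP).
    by move=> e; split=> [[y]|Py]; [rewrite (thinmx0 y)|exists 0].
  by apply: polymap_pair; [exact: polymap_id|apply: polymap_row => -[]].
pose phi (z : (E * R) * 'rV[R]_m) : E * 'rV[R]_(1 + m) :=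
  (z.1.1, row_mx z.1.2%:M z.2).
have pphi : polymap phi.
  apply: polymap_pair; first exact/polymap_fst/polymap_fst/polymap_id.
  apply: polymap_row_mx; last exact/polymap_snd/polymap_id.
  exact/polymap_scalar_mx/polyfun_pmap/polymap_snd/polymap_fst/polymap_id.
have := IH _ _ (fun z y => P z.1 (row_mx z.2%:M y)) (definable_comp pphi saP).
move=> /(definable_ex (P := fun e t => exists y, P e (row_mx t%:M y))).
apply: eq_definable => e; split => [[y Py]|[t [y Py]]]; last by exists (row_mx t%:M y).
exists (lsubmx (y : 'rV_(1 + m)) 0 0), (rsubmx (y : 'rV_(1 + m))).
by rewrite -mx11_scalar hsubmxK.
Qed.

(** The finitely many polynomials are those of the atoms of a formula; this
    form of definability forgets how the formula combines the atoms. *)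
Definition sign_determined E {cE : coordinates R E} (P : E -> Prop) :=
  exists (I : finType) (s : I -> E -> R), (forall i, polyfun (s i)) /\
    forall e e', (forall i, Num.sg (s i e) = Num.sg (s i e')) -> P e <-> P e'.

Lemma sign_determined2 E (cE : coordinates R E) (P Q S : E -> Prop) :
  sign_determined P -> sign_determined Q ->
  (forall e e', (P e <-> P e') -> (Q e <-> Q e') -> (S e <-> S e')) ->
  sign_determined S.
Proof.
move=> [I [s [ps sP]]] [J [t [pt tQ]]] PQS.
exists (I + J)%type, (fun i => match i with inl i => s i | inr j => t j end).
split=> [[]//|e e' st]; apply: PQS.
  by apply: sP => i; exact: (st (inl i)).
by apply: tQ => j; exact: (st (inr j)).
Qed.

Lemma sign_determined1 E (cE : coordinates R E) (s : E -> R) (P : E -> Prop) :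
  polyfun s -> (forall e e', Num.sg (s e) = Num.sg (s e') -> P e <-> P e') ->
  sign_determined P.
Proof.
by move=> ps sP; exists unit, (fun=> s); split=> // e e' /(_ tt); exact: sP.
Qed.

Lemma definable_sign_determined E (cE : coordinates R E) (P : E -> Prop) :
  definable P -> sign_determined P.
Proof.
move=> [f qf Pf].
suff [I [s [ps sP]]] : @sign_determined E cE (fun e => ord.holds (@coords R E cE e) f).
  by exists I, s; split=> // e e' /sP; rewrite !Pf.
have polB_term t u : GRing.rterm t && GRing.rterm u ->
    polyfun (fun e => GRing.eval (coords e) t - GRing.eval (coords e) u).
  by move=> /andP[rt ru]; apply: polyfunB; [exists t|exists u].
elim: f qf {P Pf} => //=.
- by move=> b _; exists void, (fun=> fun=> 0); split.
- move=> t u /polB_term ptu; apply: (sign_determined1 ptu) => e e' tu.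
  have sg0 (a b : R) : a = b <-> Num.sg (a - b) = 0.
    split=> [->|/eqP]; first by rewrite subrr sgr0.
    by rewrite sgr_eq0 subr_eq0 => /eqP.
  by split=> /(proj1 (sg0 _ _)) h; apply/(proj2 (sg0 _ _)); rewrite -h tu.
- move=> t u /polB_term ptu; apply: (sign_determined1 ptu) => e e' tu.
  by rewrite -subr_lt0 -sgr_lt0 tu sgr_lt0 subr_lt0.
- move=> t u /polB_term ptu; apply: (sign_determined1 ptu) => e e' tu.
  by rewrite -subr_le0 -sgr_le0 tu sgr_le0 subr_le0.
- move=> f IHf g IHg /andP[/andP[? ?] /andP[? ?]].
  apply: (@sign_determined2 _ _ (fun e => ord.holds (coords e) f)
    (fun e => ord.holds (coords e) g)) => [||e e' -> ->//].
    by apply: IHf; apply/andP.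
  by apply: IHg; apply/andP.
- move=> f IHf g IHg /andP[/andP[? ?] /andP[? ?]].
  apply: (@sign_determined2 _ _ (fun e => ord.holds (coords e) f)
    (fun e => ord.holds (coords e) g)) => [||e e' -> ->//].
    by apply: IHf; apply/andP.
  by apply: IHg; apply/andP.
- move=> f IHf g IHg /andP[/andP[? ?] /andP[? ?]].
  apply: (@sign_determined2 _ _ (fun e => ord.holds (coords e) f)
    (fun e => ord.holds (coords e) g)) => [||e e' -> ->//].
    by apply: IHf; apply/andP.
  by apply: IHg; apply/andP.
- move=> f IHf /IHf sf.
  by apply: (sign_determined2 sf sf) => e e' ->.
Qed.

Lemma definable_semialgebraic n (A : set 'rV[R]_n) : semialgebraic A -> definable A.
Proof.
move=> [cs ->].
have : definable (fun v : 'rV[R]_n => exists2 c, c \in cs & basic_semialgebraic c.1 c.2 v).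
  apply: definable_has_in => -[ps qs] /=; apply: definable_and.
    apply: definable_all_in => p; apply: definable_eq; first exact: polyfun_meval.
    exact: polyfun_cst.
  apply: definable_all_in => q; apply: definable_lt; first exact: polyfun_cst.
  exact: polyfun_meval.
by apply: eq_definable => v; split=> -[c cs_ cv]; exists c.
Qed.

End Semialgebraic.

(** * Derivatives of definable functions *)

Section Derivatives.
Variable R : realType.

(** That [d h / h] tends to [v] at 0, in polynomial terms: no quotient, and
    absolute values compared through their squares. *)
Definition small_slope (d : R -> R) (v : R) := forall e : R, 0 < e ->
  exists r : R, 0 < r /\ forall h : R, ~ (h = 0) -> - r < h -> h < r ->
    (d h - v * h) ^+ 2 <= (e * h) ^+ 2.

Lemma cvg_small_slope (d : R -> R) (v : R) :
  (h^-1 *: d h @[h --> 0^'] --> v) <-> small_slope d v.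
Proof.
have slope (e h : R) : 0 < e -> h != 0 ->
    (`|v - h^-1 *: d h| <= e) = ((d h - v * h) ^+ 2 <= (e * h) ^+ 2).
  move=> e0 h0; have sqr_le (a b : R) : (a ^+ 2 <= b ^+ 2) = (`|a| <= `|b|).
    by rewrite -[RHS](ler_pXn2r (ltn0Sn 1)) ?nnegrE // !real_normK ?num_real.
  rewrite sqr_le normrM (gtr0_norm e0).
  have -> : d h - v * h = - ((v - h^-1 *: d h) * h).
    by rewrite /GRing.scale /=; field.
  by rewrite normrN normrM ler_pM2r // normr_gt0.
split=> [/cvgrPdist_le cv e e0|sv].
  have /cv := e0; rewrite /dnbhs near_withinE => /nbhs_ballP[r /= r0 rP].
  exists r; split=> // h /eqP h0 rh hr; rewrite -slope //; apply: rP => //.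
  by rewrite /ball /= sub0r normrN ltr_norml rh.
apply/cvgrPdist_le => e e0; have [r [r0 rP]] := sv _ e0.
rewrite /dnbhs near_withinE; apply/nbhs_ballP; exists r => //= h.
rewrite /ball /= sub0r normrN ltr_norml => /andP[rh hr] h0.
by rewrite slope //; apply: rP => //; exact/eqP.
Qed.

Lemma derive_small_slope (V : normedModType R) (f : V -> R) (a u : V) (v : R) :
  derivable f a u ->
  v = 'D_u f a <-> small_slope (fun h => f (h *: u + a) - f a) v.
Proof.
move=> df.
have cD : h^-1 *: (f (h *: u + a) - f a) @[h --> 0^'] --> 'D_u f a by exact: df.
split=> [->|/cvg_small_slope cv]; first exact/cvg_small_slope.
exact: cvg_unique cv cD.
Qed.

Variables (n m : nat) (X : set 'rV[R]_n).
Implicit Types G : 'rV[R]_(n + m) -> R.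

(** Only points over [X] matter: outside the cylinder over [X] the values of
    [G] are arbitrary, and need not be definable. *)
Definition definable_fun G :=
  definable (fun z : 'rV[R]_(n + m) * R => X (lsubmx z.1) /\ z.2 = G z.1).

Lemma definable_fun_semialgebraic_on G :
  semialgebraic_on (cylinder X) G -> definable_fun G.
Proof.
move=> /definable_semialgebraic saG.
pose phi (z : 'rV[R]_(n + m) * R) := row_mx z.1 (z.2%:M : 'rV[R]_1).
have pphi : polymap phi.
  apply: polymap_row_mx; first exact/polymap_fst/polymap_id.
  exact/polymap_scalar_mx/polyfun_pmap/polymap_snd/polymap_id.
apply: eq_definable (definable_comp pphi saG) => -[w t].
rewrite /phi /graph_on /cylinder /= row_mxKl row_mxKr; split=> -[Xw] h; split=> //.
  by rewrite h.
by have := congr1 (fun A : 'rV[R]_1 => A 0 0) h; rewrite !mxE eqxx.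
Qed.

Lemma polymap_translate E (cE : coordinates R E) k (u : 'rV[R]_k)
    (f : E -> R) (phi : E -> 'rV[R]_k) :
  polyfun f -> polymap phi -> polymap (fun e => f e *: u + phi e).
Proof.
move=> pf pphi; apply: polymap_row => i.
apply: (eq_polyfun (f := fun e => f e * u 0 i + phi e 0 i)) => [e|].
  by rewrite !mxE.
by apply: polyfunD; [apply: polyfunM => //; exact: polyfun_cst|exact: polyfun_row].
Qed.

(** As [u] has no component along the first factor, the difference quotients of
    [G] at a point over [X] involve only points over the same point of [X], and
    the epsilon-delta definition of the derivative is a first-order formula
    about the graph of [G] over [X]. *)
Lemma definable_fun_derive G (u : 'rV[R]_(n + m)) : lsubmx u = 0 -> definable_fun G ->
  (forall w, X (lsubmx w) -> derivable G w u) -> definable_fun ('D_u G).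
Proof.
move=> u0 saG dG.
have Xu (w : 'rV_(n + m)) h : lsubmx (h *: u + w) = lsubmx w.
  by rewrite linearD linearZ /= u0 scaler0 add0r.
have saX : definable (fun w : 'rV[R]_(n + m) => X (lsubmx w)).
  have := definable_ex (P := fun w t => X (lsubmx w) /\ t = G w) saG.
  by apply: eq_definable => w; split=> [Xw|[t []]//]; exists (G w).
(* The values of [G] at the two points are introduced as new variables [s] and
   [t], constrained by the definable graph of [G]. *)
pose body (z : 'rV[R]_(n + m) * R) := forall e, 0 < e -> exists r, 0 < r /\
  forall h, ~ (h = 0) -> - r < h -> h < r -> exists s, exists t,
    (X (lsubmx (h *: u + z.1)) /\ s = G (h *: u + z.1)) /\
    (X (lsubmx z.1) /\ t = G z.1) /\ (s - t - z.2 * h) ^+ 2 <= (e * h) ^+ 2.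
apply: (@eq_definable _ _ _ (fun z => X (lsubmx z.1) /\ body z)).
  move=> [w v] /=; split=> -[Xw].
    move=> /(derive_small_slope v (dG w Xw)) sv; split=> // e e0.
    have [r [r0 rP]] := sv e e0; exists r; split=> // h h0 rh hr.
    by exists (G (h *: u + w)), (G w); rewrite Xu; do 2 split=> //; exact: rP.
  move=> bw; split=> //; apply/(derive_small_slope v (dG w Xw)) => e e0.
  have [r [r0 rP]] := bw e e0; exists r; split=> // h h0 rh hr.
  by have [s [t [[_ ->] [[_ ->]]]]] := rP h h0 rh hr.
apply: definable_and.
  by apply: (definable_comp _ saX); exact/polymap_fst/polymap_id.
apply: definable_forall; apply: definable_imp.
  by apply: definable_lt; [exact: polyfun_cst|exact/polyfun_pmap/polymap_snd/polymap_id].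
apply: definable_ex; apply: definable_and.
  by apply: definable_lt; [exact: polyfun_cst|exact/polyfun_pmap/polymap_snd/polymap_id].
apply: definable_forall; apply: definable_imp.
  apply: definable_not; apply: definable_eq; last exact: polyfun_cst.
  exact/polyfun_pmap/polymap_snd/polymap_id.
apply: definable_imp.
  by apply: definable_lt; [apply: polyfunN|]; apply: polyfun_pmap; polymap_proj.
apply: definable_imp.
  by apply: definable_lt; apply: polyfun_pmap; polymap_proj.
apply: definable_ex; apply: definable_ex.
apply: definable_and; last apply: definable_and.
- apply: (definable_comp (phi := fun z => (z.1.1.2 *: u + z.1.1.1.1.1.1, z.1.2)) _ saG).
  apply: polymap_pair; last exact/polymap_snd/polymap_fst/polymap_id.
  by apply: polymap_translate; [apply: polyfun_pmap|]; polymap_proj.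
- apply: (definable_comp (phi := fun z => (z.1.1.1.1.1.1, z.2)) _ saG).
  by apply: polymap_pair; polymap_proj.
- apply: definable_le; apply: polyfunX;
  [apply: polyfunB; [apply: polyfunB|apply: polyfunM]|apply: polyfunM];
  apply: polyfun_pmap; polymap_proj.
Qed.

End Derivatives.

(** * The bifurcation set is definable *)

Section Bifurcation.
Variables (R : realType) (n m : nat) (X : set 'rV[R]_n).
Implicit Types g : 'rV[R]_(n + m) -> R.

(** This replaces derivatives of the slices by derivatives of [g] on the
    product, about which [definable_fun_derive] can be used. *)
Lemma partial_slice g x (j : 'I_m) :
  partial (fun y : 'rV[R]_m => g (row_mx x y)) j =
  fun y => partial g (rshift n j) (row_mx x y).
Proof.
apply/funext => y; rewrite /partial /derive; set F := (X in lim (X @ _)).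
set F' := (X in _ = lim (X @ _)).
have -> // : F = F'; apply/funext => h; rewrite /F /F' /=.
by rewrite delta_mx_rshift scale_row_mx scaler0 add_row_mx add0r.
Qed.

Lemma bifurcation_setP g x : bifurcation_set X g x <-> X x /\ exists y : 'rV[R]_m,
  (forall j, partial g (rshift n j) (row_mx x y) = 0) /\
  \det (\matrix_(i, j) partial (partial g (rshift n j)) (rshift n i) (row_mx x y)) = 0.
Proof.
have hess y : hessian (fun y : 'rV[R]_m => g (row_mx x y)) y =
    \matrix_(i, j) partial (partial g (rshift n j)) (rshift n i) (row_mx x y).
  by apply/matrixP => i j; rewrite !mxE !partial_slice.
have grad y : gradient (fun y : 'rV[R]_m => g (row_mx x y)) y = 0 <->
    forall j, partial g (rshift n j) (row_mx x y) = 0.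
  split=> [g0 j|g0]; last by apply/rowP => j; rewrite !mxE partial_slice g0.
  by have := congr1 (fun v : 'rV[R]_m => v 0 j) g0; rewrite !mxE partial_slice.
split=> -[Xx].
  move=> /existsNP[y]; rewrite not_implyE => -[/grad g0 /negP/negPn/eqP h0].
  by split=> //; exists y; rewrite -hess.
move=> [y [g0 h0]]; split=> // /(_ y); rewrite hess h0 eqxx => h.
by have := h (proj2 (grad y) g0).
Qed.

Lemma polyfun_det E (cE : coordinates R E) k (A : E -> 'M[R]_k) :
  (forall i j, polyfun (fun e => A e i j)) -> polyfun (fun e => \det (A e)).
Proof.
move=> pA; apply: polyfun_sum => s; apply: polyfunM; first exact: polyfun_cst.
by apply: polyfun_prod => i; exact: pA.
Qed.

(** The entries of the Hessian matrix are quantified as new variables [h], so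
    that its determinant becomes a polynomial in the variables. *)
Lemma definable_bifurcation_set g : semialgebraic_on (cylinder X) g ->
  twice_continuously_differentiable (cylinder X) g -> definable (bifurcation_set X g).
Proof.
move=> /definable_fun_semialgebraic_on sag [U [_ XU [g1 g2]]].
have saX : definable X.
  pose phi (x : 'rV[R]_n) := row_mx x (0 : 'rV[R]_m).
  have pphi : polymap phi.
    apply: polymap_row_mx; first exact: polymap_id.
    by apply: polymap_row => i; exact: polyfun_cst.
  have := definable_ex (P := fun w t => X (lsubmx w) /\ t = g w) sag.
  move=> /(definable_comp pphi); apply: eq_definable => x; rewrite /phi row_mxKl.
  by split=> [Xx|[t []]//]; exists (g (row_mx x 0)).
have lsub0 (j : 'I_m) : lsubmx (delta_mx 0 (rshift n j) : 'rV[R]_(n + m)) = 0.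
  by rewrite delta_mx_rshift row_mxKl.
have sa1 j : definable_fun X (partial g (rshift n j)).
  by apply: definable_fun_derive => // w Xw; have [] := g1 (rshift n j) w (XU _ Xw).
have sa2 i j : definable_fun X (partial (partial g (rshift n j)) (rshift n i)).
  apply: definable_fun_derive => // w Xw.
  by have [] := g2 (rshift n j) (rshift n i) w (XU _ Xw).
pose Q (x : 'rV[R]_n) := exists y : 'rV[R]_m,
  (forall j, X (lsubmx (row_mx x y)) /\ 0 = partial g (rshift n j) (row_mx x y)) /\
  exists h : 'rV[R]_(m * m),
    (forall p : 'I_m * 'I_m, X (lsubmx (row_mx x y)) /\
       h 0 (mxvec_index p.1 p.2) =
         partial (partial g (rshift n p.2)) (rshift n p.1) (row_mx x y)) /\
    \det (vec_mx h) = 0.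
apply: (@eq_definable _ _ _ (fun x => X x /\ Q x)).
  move=> x; rewrite bifurcation_setP; split=> -[Xx [y]].
    move=> [g0 h0]; split=> //; exists y; rewrite row_mxKl.
    split=> [j|]; first by rewrite g0.
    exists (mxvec (\matrix_(i, j)
      partial (partial g (rshift n j)) (rshift n i) (row_mx x y))).
    by rewrite mxvecK; split=> // -[i j] /=; rewrite mxvecE mxE.
  rewrite row_mxKl => -[g0 [h [hE h0]]]; split=> //; exists y.
  split=> [j|]; first by have [_ <-] := g0 j.
  rewrite -h0; congr (\det _); apply/matrixP => i j; rewrite !mxE.
  by have [_ <-] := hE (i, j).
apply: definable_and => //; apply: definable_ex_row; apply: definable_and.
  apply: definable_forall_fin => j.
  apply: (definable_comp (phi := fun z : 'rV[R]_n * 'rV[R]_m => (row_mx z.1 z.2, 0))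
    _ (sa1 j)).
  apply: polymap_pair; last exact/polymap_scalar/polyfun_cst.
  by apply: polymap_row_mx; polymap_proj.
apply: definable_ex_row; apply: definable_and.
  apply: definable_forall_fin => -[i j] /=.
  apply: (definable_comp (phi := fun z : ('rV[R]_n * 'rV[R]_m) * 'rV[R]_(m * m) =>
    (row_mx z.1.1 z.1.2, z.2 0 (mxvec_index i j))) _ (sa2 i j)).
  apply: polymap_pair.
    by apply: polymap_row_mx; polymap_proj.
  exact/polymap_scalar/polyfun_row/polymap_snd/polymap_id.
apply: definable_eq; last exact: polyfun_cst.
apply: polyfun_det => i j.
apply: (eq_polyfun (f := fun z : ('rV[R]_n * 'rV[R]_m) * 'rV[R]_(m * m) =>
    z.2 0 (mxvec_index i j))).
  by move=> z; rewrite mxE.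
exact/polyfun_row/polymap_snd/polymap_id.
Qed.

End Bifurcation.

(** * Outer measure of a box *)

Section OuterMeasure.
Variable R : realType.
Notation mu := (@lebesgue_measure R).

Lemma nneseries_ge_term (f : (\bar R)^nat) (k : nat) :
  (forall j, (0 <= f j)%E) -> (f k <= \sum_(0 <= j <oo) f j)%E.
Proof.
move=> f0; apply: le_trans (nneseries_lim_ge (P := xpredT) k.+1 _) => //.
by rewrite big_nat_recr //= leeDr // sume_ge0.
Qed.

Definition in_box n (a b x : 'I_n -> R) := forall i, a i <= x i <= b i.

(** Countable subadditivity of the volume, by induction on the dimension.  The
    slices of the covering boxes at a given value [t] of the first coordinate
    cover the slice of the large box; integrating over [t] with respect to the
    Lebesgue measure of the line, and exchanging sum and integral, gives the
    claim.  The mask [w] selects the boxes in use: slicing at [t] drops those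
    that do not meet the hyperplane. *)
Lemma volume_le_sum_cover n (u v : 'I_n -> R) (w : nat -> bool)
    (a b : nat -> 'I_n -> R) :
  (forall i, u i <= v i) -> (forall j i, a j i <= b j i) ->
  (forall x, in_box u v x -> exists2 j, w j & in_box (a j) (b j) x) ->
  ((\prod_i (v i - u i))%:E <=
     \sum_(0 <= j <oo) ((w j)%:R * \prod_i (b j i - a j i))%:E)%E.
Proof.
elim: n u v w a b => [|n IH] u v w a b uv ab cover.
  rewrite big_ord0; have [|j wj _] := cover u; first by case.
  apply: le_trans (nneseries_ge_term j _) => [|k].
    by rewrite wj big_ord0 mulr1.
  by rewrite lee_fin mulr_ge0 // big_ord0.
pose tl (x : 'I_n.+1 -> R) := fun i => x (lift ord0 i).
pose V := \prod_i (tl v i - tl u i).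
pose W j := \prod_i (tl (b j) i - tl (a j) i).
have V0 : 0 <= V by apply: prodr_ge0 => i _; rewrite subr_ge0 uv.
have W0 j : 0 <= W j by apply: prodr_ge0 => i _; rewrite subr_ge0 ab.
have wW0 j : 0 <= (w j)%:R * W j by rewrite mulr_ge0.
pose I : set R := [set` `[u ord0, v ord0]].
pose J j : set R := [set` `[a j ord0, b j ord0]].
have slice t : I t -> (V%:E <=
    \sum_(0 <= j <oo) (((w j)%:R * W j)%:E * (\1_(J j) t)%:E))%E.
  move=> It.
  apply: le_trans (IH (tl u) (tl v) (fun j => w j && (t \in J j))
    (fun j => tl (a j)) (fun j => tl (b j)) _ _ _) _.
  - by move=> i; exact: uv.
  - by move=> j i; exact: ab.
  - move=> y uyv; pose x i := if unlift ord0 i is Some k then y k else t.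
    have x0 : x ord0 = t by rewrite /x unlift_none.
    have xl i : x (lift ord0 i) = y i by rewrite /x liftK.
    have [|j wj xj] := cover x.
      move=> i; case: (unliftP ord0 i) => [k ->|->]; rewrite ?xl ?x0; first exact: uyv.
      by have := It; rewrite /I /= in_itv.
    exists j; last by move=> i; rewrite -xl; exact: xj.
    by rewrite wj /= inE /J /= in_itv /= -x0; exact: xj.
  - apply: lee_nneseries => [j _ _|j _].
      by rewrite lee_fin mulr_ge0 //; exact: W0.
    rewrite -EFinM lee_fin indicE mulrAC -natrM mulnb /W; exact: lexx.
have mI : measurable I by exact: measurable_itv.
have mJ j : measurable (J j) by exact: measurable_itv.
have volE j : (w j)%:R * \prod_i (b j i - a j i) =
    (w j)%:R * W j * (b j ord0 - a j ord0).
  by rewrite big_ord_recl /W /tl; ring.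
have mu_itv (c d : R) : c <= d -> mu [set` `[c, d]] = (d - c)%:E.
  move=> cd; rewrite lebesgue_measure_itv /= lte_fin; case: ltP => [_|dc].
    by rewrite EFinB.
  by rewrite (@le_anti _ _ c d) ?subrr // cd.
rewrite big_ord_recl -/V EFinM muleC -mu_itv // -integral_cst //.
apply: le_trans (_ : (\int[mu]_(t in I)
   \sum_(0 <= j <oo) (((w j)%:R * W j)%:E * (\1_(J j) t)%:E) <= _)%E).
  apply: ge0_le_integral => //.
  apply: (@ge0_emeasurable_sum _ _ _ _ _ xpredT) => [j t _ _|j _].
    by rewrite mule_ge0 // lee_fin.
  by apply: measurable_funeM; apply/measurable_EFinP; exact: (measurable_indic (mJ j)).
rewrite integral_nneseries //.
- apply: lee_nneseries => [j _ _|j _].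
    by apply: integral_ge0 => t _; rewrite mule_ge0 // lee_fin.
  rewrite ge0_integralZl_EFin //.
  + rewrite integral_indic //; last exact: mJ.
    rewrite volE [leRHS]EFinM; apply: lee_wpmul2l; first by rewrite lee_fin.
    rewrite -mu_itv //; apply: le_measure; rewrite ?inE.
    * by apply: measurableI; [exact: mJ|exact: mI].
    * exact: mJ.
    * exact: subIsetl.
  + by apply/measurable_EFinP; exact: (measurable_indic (mJ j)).
- move=> j; apply: measurable_funeM; apply/measurable_EFinP.
  exact: (measurable_indic (mJ j)).
- by move=> j t _; rewrite mule_ge0 // lee_fin.
Qed.
End OuterMeasure.

(** * Definable null sets *)

Section NullSets.
Variable R : realType.

Lemma lebesgue_outer_box n (u v : 'rV[R]_n) (A : set 'rV[R]_n) :
  (forall i, u 0 i <= v 0 i) -> box u v `<=` A ->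
  ((\prod_(i < n) (v 0 i - u 0 i))%:E <= lebesgue_outer A)%E.
Proof.
move=> uv boxA; apply: le_ereal_inf_tmp => _ [D [a [b [ab AD ->]]]].
apply: le_trans (@volume_le_sum_cover R n (u 0) (v 0) (fun j => j \in D)
  (fun j => a j 0) (fun j => b j 0) uv ab _) _.
  move=> x xuv; have [|j Dj abj] := AD (\row_i x i).
    by apply: boxA => i; rewrite mxE; exact: xuv.
  by exists j => [|i]; [rewrite inE|have := abj i; rewrite mxE].
rewrite esum_mkcond nneseries_esum; last first.
  move=> j _; rewrite lee_fin mulr_ge0 //.
  by apply: prodr_ge0 => i _; rewrite subr_ge0.
rewrite le_eqVlt; apply/orP; left; apply/eqP.
rewrite (_ : [set x | _] = [set: nat]); last by apply/seteqP; split.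
apply: eq_esum => j _.
by case: (j \in D); rewrite ?mul1r ?mul0r.
Qed.

Lemma polyfun_continuous n (f : 'rV[R]_n -> R) : polyfun f -> continuous f.
Proof.
move=> [t rt fE].
have -> : f = fun x => GRing.eval (@coords R _ (coordinates_row R n) x) t.
  exact/funext.
elim: t rt {fE} => //=.
- move=> i _; case: (ltnP i n) => i_n.
    rewrite (_ : (fun x => _) = fun x : 'rV[R]_n => x 0 (Ordinal i_n)).
      exact: coord_continuous.
    apply/funext => x; rewrite (nth_map (Ordinal i_n)) ?size_enum_ord //.
    by rewrite (nth_ord_enum _ (Ordinal i_n)).
  rewrite (_ : (fun x => _) = fun=> 0); first exact: cst_continuous.
  by apply/funext => x; rewrite nth_default // size_map size_enum_ord.
- by move=> c _; exact: cst_continuous.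
- by move=> k _; exact: cst_continuous.
- by move=> s IHs t IHt /andP[/IHs cs /IHt ct] x; apply: (continuousD (cs x) (ct x)).
- by move=> t IH /IH ct x; apply: (continuousN (ct x)).
- move=> t IH k /IH ct x; under eq_fun do rewrite -mulr_natr.
  by apply: (continuousM (ct x)); exact: cst_continuous.
- by move=> s IHs t IHt /andP[/IHs cs /IHt ct] x; apply: (continuousM (cs x) (ct x)).
- move=> t IH k /IH ct x.
  apply: (@continuous_comp _ _ _ _ (fun y : R => y ^+ k)); first exact: ct.
  exact: exprn_continuous.
Qed.

Lemma near_sg_eq n (f : 'rV[R]_n -> R) x : polyfun f -> f x != 0 ->
  \forall y \near x, Num.sg (f y) = Num.sg (f x).
Proof.
move=> /polyfun_continuous cf; rewrite neq_lt => /orP[fx|fx].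
  near=> y; rewrite (ltr0_sg fx) ltr0_sg //; near: y.
  exact: (cvgr_lt (f x) (cf x) 0 fx).
near=> y; rewrite (gtr0_sg fx) gtr0_sg //; near: y.
exact: (cvgr_gt (f x) (cf x) 0 fx).
Unshelve. all: by end_near. Qed.

(** Where none of the polynomials that are not identically zero vanishes, all
    the signs that decide membership in [A] are locally constant; a point of [A]
    of this kind would be the centre of a box contained in [A]. *)
Lemma null_definable_sub_zeros n (A : set 'rV[R]_n) :
  definable A -> lebesgue_outer A = 0%E ->
  exists (I : finType) (s : I -> 'rV[R]_n -> R),
    [/\ forall i, polyfun (s i), forall i, exists x, s i x != 0 &
        forall x, A x -> exists i, s i x = 0].
Proof.
move=> /definable_sign_determined[I [s [ps sA]]] A0.
(* The polynomials that vanish identically have constant sign 0, hence carry no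
   information; keeping them would make the conclusion void. *)
pose J := {i : I | `[< exists x, s i x != 0 >]}.
exists J, (fun j => s (val j)); split=> [j|j|x Ax]; first exact: ps.
  by apply/asboolP; exact: (valP j).
apply: contrapT => /forallNP sx0.
have nearA : \forall y \near x, A y.
  have : \forall y \near x, forall i, Num.sg (s i y) = Num.sg (s i x).
    apply: (filter_forall (nbhs_filter x)) => i.
    have [si|/forallNP si] := pselect (exists x, s i x != 0).
      apply: near_sg_eq => //; apply/eqP.
      by have /asboolP pi := si; exact: (sx0 (exist _ i pi)).
    have s0 y : s i y = 0 by apply/eqP/negPn/negP/si.
    by near=> y; rewrite !s0.
  by apply: filterS => y sxy; apply/(sA _ _ sxy).
have /nbhs_ballP[e /= e0 eA] := nearA.
pose u := \row_i (x 0 i - e / 2); pose v := \row_i (x 0 i + e / 2).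
have uv i : u 0 i <= v 0 i by rewrite !mxE; lra.
have boxA : box u v `<=` A.
  move=> y yuv; apply: eA; split=> [|i j]; first exact: e0.
  rewrite ord1 /ball /= distrC ltr_distl.
  by have := yuv j; rewrite !mxE; lra.
have := lebesgue_outer_box uv boxA.
rewrite A0 lee_fin leNgt => /negP; apply; apply: prodr_gt0 => i _.
by rewrite !mxE; lra.
Unshelve. all: by end_near. Qed.
End NullSets.

(** * Covering zero sets by small cubes *)

Section Covering.
Variable R : realType.

Lemma sep_poly_affine n d (f : ('I_n -> R) -> R) (a h : R) : sep_poly d f ->
  sep_poly d (fun x => f (fun i => a + h * x i)).
Proof.
move=> fd i x; have [q sq qE] := fd i (fun j => a + h * x j).
exists (q \Po (h *: 'X + a%:P)).
  have s2 : (size (h *: 'X + a%:P)%R <= 2)%N.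
    apply: leq_trans (size_polyD _ _) _; rewrite geq_max.
    rewrite (leq_trans (size_scale_leq _ _)) ?size_polyX //=.
    by rewrite (leq_trans (size_polyC_leq1 _)).
  apply: leq_trans (size_comp_poly_leq _ _) _; rewrite ltnS; nia.
move=> t; rewrite horner_comp !hornerE -qE; congr f; apply/funext => j.
by rewrite /upd; case: eqP => // _; rewrite addrC.
Qed.

(** The degree bound is read off the term, so that it is the same on all
    lines. *)
Lemma polyfun_sep_poly n (f : 'rV[R]_n -> R) : polyfun f ->
  exists d : nat, sep_poly (fun=> d) (fun x : 'I_n -> R => f (\row_i x i)).
Proof.
move=> [t rt fE].
have -> : f = fun x => GRing.eval (@coords R _ (coordinates_row R n) x) t.
  exact/funext.
elim: t rt {fE} => //=.
- move=> k _; exists 1%N => i x; case: (ltnP k n) => kn; last first.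
    exists 0 => [|t]; first by rewrite size_poly0.
    by rewrite horner0 nth_default // size_map size_enum_ord.
  have e (y : 'I_n -> R) : [seq (\row_j y j) 0 j | j <- enum 'I_n]`_k = y (Ordinal kn).
    rewrite (nth_map (Ordinal kn)) ?size_enum_ord //.
    by rewrite (nth_ord_enum _ (Ordinal kn)) mxE.
  case: (eqVneq (Ordinal kn) i) => [ki|ki].
    by exists 'X => [|t]; rewrite ?size_polyX // hornerX e ki upd_same.
  exists (x (Ordinal kn))%:P => [|t]; last by rewrite hornerC e upd_neq.
  by rewrite (leq_trans (size_polyC_leq1 _)).
- move=> c _; exists 0%N => i x; exists c%:P => [|t]; last by rewrite hornerC.
  exact: size_polyC_leq1.
- move=> k _; exists 0%N => i x; exists k%:R%:P => [|t]; last by rewrite hornerC.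
  exact: size_polyC_leq1.
- move=> s IHs t IHt /andP[/IHs[c sc] /IHt[d td]]; exists (c + d)%N => i x.
  have [p sp pE] := sc i x; have [q sq qE] := td i x.
  exists (p + q) => [|u]; last by rewrite hornerD -pE -qE.
  by apply: leq_trans (size_polyD _ _) _; rewrite geq_max; lia.
- move=> t IH /IH[d td]; exists d => i x; have [q sq qE] := td i x.
  by exists (- q) => [|u]; rewrite ?size_polyN // hornerN -qE.
- move=> t IH k /IH[d td]; exists d => i x; have [q sq qE] := td i x.
  exists (q *+ k) => [|u]; last by rewrite hornerMn -qE.
  by rewrite -scaler_nat (leq_trans (size_scale_leq _ _)).
- move=> s IHs t IHt /andP[/IHs[c sc] /IHt[d td]]; exists (c + d)%N => i x.
  have [p sp pE] := sc i x; have [q sq qE] := td i x.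
  exists (p * q) => [|u]; last by rewrite hornerM -pE -qE.
  by apply: leq_trans (size_polyMleq _ _) _; lia.
- move=> t IH k /IH[d td]; exists (d * k)%N => i x; have [q sq qE] := td i x.
  exists (q ^+ k) => [|u]; last by rewrite horner_exp -qE.
  by apply: leq_trans (size_poly_exp_leq _ _) _; rewrite ltnS leq_mul2r; lia.
Qed.

(** The cube [(-M, M)^n] is mapped to [(0, K)^n] by an affine change of
    variables that preserves the degrees, hence the constant of
    [card_zero_cells]. *)
Lemma zeros_cover n (I : finType) (s : I -> 'rV[R]_n -> R)
    (A : set 'rV[R]_n) (M : R) :
  0 < M -> (forall i, polyfun (s i)) -> (forall i, exists x, s i x != 0) ->
  (forall x, A x -> exists i, s i x = 0) ->
  (forall x, A x -> forall j, `|x 0 j| < M) ->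
  exists C : nat, forall K, (0 < K)%N -> exists N (c : 'I_N -> 'rV[R]_n),
    (N <= C * K ^ n.-1)%N /\
    forall x, A x -> exists l, forall j, `|x 0 j - c l 0 j| <= 2 * M / K%:R.
Proof.
move=> M0 ps s0 As AM.
have /choice[d dP] : forall i, exists d : nat,
    sep_poly (fun=> d) (fun x : 'I_n -> R => s i (\row_j x j)).
  by move=> i; exact: polyfun_sep_poly.
have [C CP] := card_zero_cells R n (\sum_(i : I) n * d i).
exists (#|I| * C)%N => K K0; pose h := 2 * M / K%:R.
have K0R : 0 < K%:R :> R by rewrite ltr0n.
have h0 : 0 < h by rewrite divr_gt0 // mulr_gt0.
pose f i := fun x : 'I_n -> R => s i (\row_j (- M + h * x j)).
pose Z := (\bigcup_i zero_cells K (f i))%SET.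
exists #|Z|, (fun l : 'I_#|Z| => \row_j (- M + h * (enum_val l j : nat)%:R)); split.
  apply: (@leq_trans (\sum_(i : I) #|zero_cells K (f i)|)).
    rewrite /Z; elim/big_ind2 : _ => [|B b B' b' Bb Bb'|//]; first by rewrite cards0.
    by apply: leq_trans (leq_card_setU _ _).1 _; exact: leq_add.
  rewrite -mulnA -sum_nat_const; apply: leq_sum => i _; apply: (CP (fun=> d i)).
  - by rewrite sum_nat_const card_ord (bigD1 i)//= leq_addr.
  - exact: (sep_poly_affine _ _ (dP i)).
  - have [x sx] := s0 i; exists (fun j => (x 0 j + M) / h); rewrite /f.
    rewrite (_ : \row_j _ = x) //; apply/rowP => j; rewrite mxE.
    by field; rewrite gt_eqF.
move=> x Ax; have [i six] := As _ Ax.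
pose y j := (x 0 j + M) / h.
have yx j : - M + h * y j = x 0 j by rewrite /y; field; rewrite gt_eqF.
have yK j : 0 <= y j < K%:R.
  have := AM _ Ax j; rewrite ltr_norml => /andP[xM Mx].
  apply/andP; split; first by rewrite divr_ge0 ?(ltW h0) //; lra.
  rewrite ltr_pdivrMr // (_ : K%:R * h = 2 * M); first by lra.
  by rewrite /h; field; rewrite gt_eqF.
have tK j : (Num.trunc (y j) < K)%N.
  have /andP[y0 yK'] := yK j; rewrite -(ltr_nat R).
  by apply: le_lt_trans yK'; have /andP[] := truncn_itv y0.
pose k : {ffun 'I_n -> 'I_K} := [ffun l : 'I_n => Ordinal (tK l)].
have ky : cell k y.
  by move=> j; rewrite ffunE /=; apply: truncn_itv; have /andP[] := yK j.
have kZ : k \in Z.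
  apply/finset.bigcupP; exists i => //; apply/zero_cellsP; exists y => //.
  by rewrite /f (_ : \row_j _ = x) //; apply/rowP => j; rewrite mxE yx.
exists (enum_rank_in kZ k) => j; rewrite mxE enum_rankK_in //.
have /andP[k1 k2] := ky j; rewrite -yx opprD addrACA subrr add0r -mulrBr normrM.
rewrite gtr0_norm // -/h ger_pMr // ger0_norm ?subr_ge0 //.
by rewrite lerBlDr addrC -natr1 in k2 *; lra.
Qed.
End Covering.

(** * Minkowski dimension *)

Section Dimension.
Variable R : realType.

Lemma near_right_itv (a : R) : 0 < a -> \forall r \near 0^'+, 0 < r < a.
Proof.
move=> a0; near=> r; apply/andP; split; near: r; first exact: nbhs_right_gt.
exact: nbhs_right_lt.
Unshelve. all: by end_near. Qed.

Lemma upper_minkowski_dim_le n (A : set 'rV[R]_n) (p : nat) (C : R) : 0 < C ->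
  (forall r, 0 < r -> r < 1 -> (covering_number A r <= (C * r^-1 ^+ p)%:E)%E) ->
  (upper_minkowski_dim A <= p%:R%:E)%E.
Proof.
move=> C0 AC; apply/lee_addgt0Pr => e e0.
(* For [r < r0] one has [|ln C| / - ln r < e], which absorbs the constant
   [C]. *)
pose r0 := expR (- (`|ln C| / e + 1)).
have r00 : 0 < r0 by exact: expR_gt0.
apply: ge_ereal_inf.
pose V : set R := [set r | 0 < r < r0].
exists (ereal_sup [set (lne (covering_number A r) * ((- ln r)^-1)%:E)%E | r in V]).
  by exists V => //; exact: near_right_itv.
apply: ge_ereal_sup => _ [r /andP[r_gt0 rr0] <-].
have lnr : `|ln C| / e + 1 < - ln r.
  by rewrite ltrNr -[ltRHS]expRK ltr_ln ?posrE.
have Ce : 0 <= `|ln C| / e by rewrite divr_ge0 // ltW.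
have L0 : 0 < - ln r by lra.
have r1 : r < 1 by rewrite -(ltr_ln (R := R)) ?posrE // ln1; lra.
have Cr0 : 0 < C * r^-1 ^+ p by rewrite mulr_gt0 // exprn_gt0 // invr_gt0.
have cov0 : (0 <= covering_number A r)%E.
  by apply: le_ereal_inf_tmp => _ [k _ <-]; rewrite lee_fin.
have lnecov : (lne (covering_number A r) <= (ln C + (- ln r) *+ p)%:E)%E.
  rewrite -lnV ?posrE // -lnXn ?invr_gt0 // -lnM ?posrE ?exprn_gt0 ?invr_gt0 //.
  rewrite -lne_EFin // lee_lne ?in_itv /= ?leey ?andbT ?lee_fin ?(ltW Cr0) //.
  exact: AC.
apply: le_trans (lee_wpmul2r _ lnecov) _; first by rewrite lee_fin invr_ge0 ltW.
rewrite -EFinM -EFinD lee_fin ler_pdivrMr // mulrDl.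
rewrite (_ : - ln r *+ p = p%:R * - ln r); last by rewrite mulr_natl.
have : `|ln C| < - ln r * e by rewrite -ltr_pdivrMr //; lra.
by have := ler_norm (ln C); lra.
Unshelve. all: by end_near. Qed.

Lemma covering_number_le n (A : set 'rV[R]_n) (r : R) N (c : 'I_N -> 'rV[R]_n) :
  (forall x, A x -> exists l, euclidean_ball (c l) r x) ->
  (covering_number A r <= N%:R%:E)%E.
Proof.
move=> Ac; apply: ge_ereal_inf; exists N%:R%:E => //; exists N => //.
by exists c => x /Ac[l xl]; exists l.
Qed.

(** The bound [sqrt n.+1 * (r / n.+1) <= r] on the half diagonal of the cube is
    crude, but constants do not matter for the dimension. *)
Lemma euclidean_ball_cube n (c x : 'rV[R]_n.+1) (r : R) :
  (forall j, `|x 0 j - c 0 j| <= r / n.+1%:R) -> euclidean_ball c r x.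
Proof.
move=> xc; have r0 : 0 <= r.
  by have := le_trans (normr_ge0 _) (xc ord0); rewrite pmulr_lge0 // invr_gt0.
rewrite /euclidean_ball /= -[leRHS](ger0_norm r0) -sqrtr_sqr ler_sqrt ?sqr_ge0 //.
have n1 : 1 <= n.+1%:R :> R by rewrite ler1n.
have n0 : 0 < n.+1%:R :> R by rewrite ltr0n.
apply: le_trans (_ : \sum_(i < n.+1) (r / n.+1%:R) ^+ 2 <= _).
  apply: ler_sum => i _; rewrite -real_normK ?num_real //.
  by rewrite ler_pXn2r ?nnegrE ?divr_ge0 // ltW.
rewrite (_ : \sum_(i < _) _ = r ^+ 2 / n.+1%:R).
  by rewrite ler_pdivrMr // ler_peMr // sqr_ge0.
rewrite sumr_const card_ord -[LHS]mulr_natr.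
by field; rewrite addrC natr1 gt_eqF.
Qed.

Lemma upper_minkowski_dim_null_definable n (A : set 'rV[R]_n.+1) : bounded_set A ->
  definable A -> lebesgue_outer A = 0%E -> (upper_minkowski_dim A <= n%:R%:E)%E.
Proof.
move=> bA saA A0.
have [I [s [ps s0 As]]] := null_definable_sub_zeros saA A0.
have [M [M0 AM]] : exists M : R, 0 < M /\ forall x, A x -> forall j, `|x 0 j| < M.
  have [M0 [_ AM]] := bA.
  exists (`|M0| + 2); split=> [|x Ax j]; first by rewrite ltr_wpDl.
  apply: (@le_lt_trans _ _ (`|M0| + 1)); last by lra.
  have : `|x| <= `|M0| + 1.
    by apply: AM => //; apply: le_lt_trans (ler_norm _) _; lra.
  apply: le_trans; rewrite [leRHS](_ : _ = mx_norm x) // mx_normrE.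
  exact: (le_bigmax _ (fun ij : 'I_1 * 'I_n.+1 => `|x ij.1 ij.2|) (0, j)).
have [C CP] := zeros_cover M0 ps s0 As AM.
pose B := 2 * M * n.+1%:R.
have B0 : 0 < B by rewrite !mulr_gt0 // ltr0n.
apply: (@upper_minkowski_dim_le _ _ _ (C.+1%:R * (B + 1) ^+ n)).
  by rewrite mulr_gt0 ?ltr0n // exprn_gt0 // addr_gt0.
move=> r r0 r1.
(* As [K > B / r], the side [2 * M / K] of the cells is at most [r / n.+1]. *)
pose K := (Num.trunc (B / r)).+1.
have Br0 : 0 <= B / r by rewrite divr_ge0 // ltW.
have /andP[K1 K2] := truncn_itv Br0.
have K0 : 0 < K%:R :> R by rewrite ltr0n.
have [N [c [NC cA]]] := CP K (ltn0Sn _).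
apply: le_trans (covering_number_le (c := c) _) _.
  move=> x /cA[l xl]; exists l; apply: euclidean_ball_cube => j.
  apply: le_trans (xl j) _; rewrite ler_pdivrMr // mulrAC ler_pdivlMr ?ltr0n //.
  by rewrite -/B -ler_pdivrMl // mulrC ltW.
rewrite lee_fin -mulrA -exprMn.
have KB : K%:R <= (B + 1) / r.
  by rewrite -natr1 mulrDl lerD // mul1r invf_ge1 ?ltW.
apply: (@le_trans _ _ (C%:R * K%:R ^+ n)).
  by rewrite -natrX -natrM ler_nat.
apply: ler_pM; rewrite ?ler_nat ?exprn_ge0 //.
by apply: lerXn2r; rewrite ?nnegrE // divr_ge0 ?addr_ge0 // ltW.
Qed.

(** In dimension 0, every box has volume 1. *)
Lemma lebesgue_outer0_row0 (A : set 'rV[R]_0) : lebesgue_outer A = 0%E -> A = set0.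
Proof.
move=> A0; apply/seteqP; split=> // x Ax.
have : box x x `<=` A by move=> y _; rewrite (_ : y = x) //; apply/rowP => -[].
move=> /(lebesgue_outer_box (fun i => lexx _)).
by rewrite A0 big_ord0 lee_fin ler10.
Qed.

Lemma upper_minkowski_dim_set0 n : upper_minkowski_dim (set0 : set 'rV[R]_n) = -oo%E.
Proof.
apply/eqP; rewrite -leeNy_eq; apply: ge_ereal_inf.
pose V : set R := [set r | 0 < r < 1].
exists (ereal_sup [set (lne (covering_number (set0 : set 'rV[R]_n) r) *
    ((- ln r)^-1)%:E)%E | r in V]).
  by exists V => //; exact: near_right_itv.
apply: ge_ereal_sup => _ [r /andP[r0 r1] <-].
rewrite le0_lneNy.
  by rewrite gt0_mulNye // lte_fin invr_gt0 oppr_gt0 ln_lt0 // r0.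
exact: (@covering_number_le _ _ _ 0 (fun=> 0)).
Unshelve. all: by end_near. Qed.

End Dimension.

Theorem theorem4p1 (R : realType) (n m : nat)
    (X : set 'rV[R]_n) (g : 'rV[R]_(n + m) -> R)
    (convexX : convex_set (X : set (convex_lmodType 'rV[R]_n)))
    (compactX : compact X)
    (g_C2 : twice_continuously_differentiable (@cylinder R n m X) g)
    (g_semialgebraic : semialgebraic_on (@cylinder R n m X) g)
    (g_morse_ae : ae_in X (fun x => morse (fun y : 'rV[R]_m => g (row_mx x y)))) :
  (upper_minkowski_dim (bifurcation_set X g) <= (n%:R - 1)%:E)%E.
Proof.
have saB := definable_bifurcation_set g_semialgebraic g_C2.
case: n X g convexX compactX g_C2 g_semialgebraic g_morse_ae saB
  => [|n] X g _ cX _ _ ae saB.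
  (* The claimed bound is -1: the bifurcation set has to be empty. *)
  have -> : bifurcation_set X g = set0 by exact: lebesgue_outer0_row0 ae.
  by rewrite upper_minkowski_dim_set0 leNye.
rewrite -natr1 addrK; apply: upper_minkowski_dim_null_definable => //.
have [M [Mr MX]] := compact_bounded cX.
by exists M; split=> // y My x [Xx _]; exact: MX.
Qed.
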